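(* Assume that $\bar f(0)=\bar f(1)=0$, and set $F(u):=\int_0^u\bar f(s)\,ds$ for $u\in[0,1]$. Then the equation $$v_t=A_0v_{zz}+\bar f(v),\qquad t\in\mathbb{R},\ z\in\mathbb{R},$$ admits a traveling wave connecting $0$ and $1$ with speed $c_0\neq0$ provided that one of the following conditions holds: (a) $F(1)<0$ and $\bar f(u)<0$ for all $u\in\{u\in(0,1):F(u)>F(1)\}$; (b) $F(1)>0$ and $\bar f(u)>0$ for all $u\in\{u\in(0,1):F(u)>F(0)\}$. Furthermore, $c_0>0$ (resp. $c_0<0$) if (b) (resp. (a)) holds true.
   Context: $A_0>0$ is a positive constant. The function $\bar f:\mathbb{R}\to\mathbb{R}$ is the average $\bar f(u)=\frac{1}{L_1\cdots L_d}\int_{(0,L_1)\times\cdots\times(0,L_d)}f(x,u)\,dx$, where $L_1,\dots,L_d>0$ and $f:\mathbb{R}^d\times\mathbb{R}\to\mathbb{R}$ is of class $C^1$, $(L_1,\dots,L_d)$-periodic in $x$, with $u\mapsto\partial_uf(x,u)$ locally Lipschitz continuous uniformly in $x\in\mathbb{R}^d$; in particular $\bar f$ is of class $C^1$ with locally Lipschitz derivative. A traveling wave connecting $0$ and $1$ with speed $c_0$ is a solution of the form $v(t,z)=\phi_0(z-c_0t)$ with $\phi_0(-\infty)=1$ and $\phi_0(+\infty)=0$. *)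

(* Defs.v *)
From Stdlib Require Export Reals.
From mathcomp Require Export ssreflect ssrfun ssrbool eqtype ssrnat seq fintype bigop.
From Coquelicot Require Export Coquelicot.

Set Implicit Arguments.
Unset Strict Implicit.
Unset Printing Implicit Defensive.

Open Scope R_scope.

(* Points of R^d are functions ['I_d -> R]; Coquelicot equips this type with
   the topology of the sup norm (fct_UniformSpace). *)

Definition update (d : nat) (x : 'I_d -> R) (i : 'I_d) (s : R) : 'I_d -> R :=
  fun j => if j == i then s else x j.

Definition partial_x (d : nat) (f : ('I_d -> R) -> R -> R) (i : 'I_d)
    (x : 'I_d -> R) (u : R) : R :=
  Derive (fun s => f (update x i s) u) (x i).

Definition partial_u (d : nat) (f : ('I_d -> R) -> R -> R)
    (x : 'I_d -> R) (u : R) : R :=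
  Derive (f x) u.

Definition jointly_continuous (d : nat) (g : ('I_d -> R) -> R -> R) : Prop :=
  forall p : ('I_d -> R) * R,
    continuous (fun q : ('I_d -> R) * R => g q.1 q.2) p.

(* [Derive] is total, with a junk value where the derivative does not exist,
   hence the explicit [ex_derive] clauses here and in [classical_solution]. *)
Definition class_C1 (d : nat) (f : ('I_d -> R) -> R -> R) : Prop :=
  [/\ jointly_continuous f,
      forall i x u, ex_derive (fun s => f (update x i s) u) (x i),
      forall x u, ex_derive (f x) u,
      forall i, jointly_continuous (partial_x f i)
    & jointly_continuous (partial_u f)].

Definition periodic_x (d : nat) (L : 'I_d -> R) (f : ('I_d -> R) -> R -> R) :
    Prop :=
  forall (k : 'I_d -> Z) x u, f (fun i => x i + IZR (k i) * L i) u = f x u.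

Definition locally_lipschitz_u (d : nat) (g : ('I_d -> R) -> R -> R) : Prop :=
  forall u0 : R, exists delta K : R, 0 < delta /\
    forall x u v, Rabs (u - u0) < delta -> Rabs (v - u0) < delta ->
      Rabs (g x u - g x v) <= K * Rabs (u - v).

Definition cons_pt (d : nat) (s : R) (y : 'I_d -> R) : 'I_d.+1 -> R :=
  fun i => if unlift ord0 i is Some j then y j else s.

(* The integral over (0,L_1) x ... x (0,L_d) of a continuous function, as an
   iterated Riemann integral (first coordinate outermost). *)
Fixpoint box_integral (d : nat) :
    ('I_d -> R) -> (('I_d -> R) -> R) -> R :=
  match d with
  | O => fun _ g => g (fun _ => 0)
  | d'.+1 => fun L g =>
      RInt (fun s => box_integral (fun i : 'I_d' => L (lift ord0 i))
                                  (fun y => g (cons_pt s y)))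
           0 (L ord0)
  end.

Definition average (d : nat) (L : 'I_d -> R) (f : ('I_d -> R) -> R -> R)
    (u : R) : R :=
  / (\big[Rmult/1]_(i < d) L i) * box_integral L (fun x => f x u).

Definition primitive (g : R -> R) (u : R) : R := RInt g 0 u.

(* [v] (time first) is of class C^1 in t and C^2 in z and solves
   v_t = A0 v_zz + g(v) pointwise on R x R. *)
Definition classical_solution (A0 : R) (g : R -> R) (v : R -> R -> R) : Prop :=
  (forall t z : R,
    [/\ ex_derive (fun s => v s z) t,
        ex_derive (v t) z,
        ex_derive (Derive (v t)) z
      & Derive (fun s => v s z) t = A0 * Derive (Derive (v t)) z + g (v t z)]) /\
  (forall p : R * R,
    [/\ continuous (fun q : R * R => v q.1 q.2) p,
        continuous (fun q : R * R => Derive (fun s => v s q.2) q.1) p,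
        continuous (fun q : R * R => Derive (v q.1) q.2) p
      & continuous (fun q : R * R => Derive (Derive (v q.1)) q.2) p]).

Definition traveling_wave (A0 : R) (g : R -> R) (c0 : R) (phi0 : R -> R) :
    Prop :=
  [/\ classical_solution A0 g (fun t z => phi0 (z - c0 * t)),
      is_lim phi0 m_infty 1
    & is_lim phi0 p_infty 0].

Definition condition_a (g : R -> R) : Prop :=
  primitive g 1 < 0 /\
  forall u : R, 0 < u < 1 -> primitive g u > primitive g 1 -> g u < 0.

Definition condition_b (g : R -> R) : Prop :=
  primitive g 1 > 0 /\
  forall u : R, 0 < u < 1 -> primitive g u > primitive g 0 -> g u > 0.

(* Main.v *)
(* Writing q(u) = phi'^2 / 2 along a decreasing front phi = u of
   phi'' + c phi' + g(phi) = 0 gives q' = c sqrt(2 q) - g(u), q(1) = 0.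
   This Cauchy problem, solved from u = 1 towards u = 0, is dissipative, so q
   exists on [0, 1], is unique and depends continuously on c.
   Under (b) the orbit stays positive on [0, 1) for c = 0 and not for large c;
   for the supremum c* of the speeds for which it does, q vanishes at u = 0 and
   only there, and solving phi' = - sqrt(2 q(phi)) yields the wave, with c* > 0.
   Condition (a) reduces to (b) by u -> 1 - u, z -> - z. The sign of the speed
   of an arbitrary wave follows from the energy phi'^2 / 2 + F(phi), which is
   monotone in z. *)
Require Import Defs.
From Stdlib Require Import Lra Classical ClassicalEpsilon FunctionalExtensionality.

Set Implicit Arguments.
Unset Strict Implicit.
Unset Printing Implicit Defensive.

(** * Continuity, derivatives and barriers *)

(** The obstacle is the square root: [slope] is not Lipschitz at 0, and [q] vanishes at the ends of
    the front, so Picard iteration and Gronwall estimates are not at hand. Monotonicity replaces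
    them: for [c >= 0] friction, followed from 1 towards 0, can only shrink the gap between two
    solutions. It is then enough to know the sign of a derivative at the points where a bound is
    violated, and most estimates below are barrier arguments of this kind. Since [slope] is 0 on
    negative energies, every orbit lives on all of [0, 1], and loss of positivity is a property of a
    global solution instead of a breakdown. At the critical speed two difficulties remain: orbits
    tend to 0 at 1, where compactness leaves no margin, and a zero might appear inside (0, 1).
    Condition (b) settles both. *)

Lemma continuous_Rplus (U : UniformSpace) (f g : U -> R) x :
  continuous f x -> continuous g x -> continuous (fun y => f y + g y) x.
Proof. by move=> hf hg; exact: (continuous_plus f g x hf hg). Qed.

Lemma continuous_Ropp (U : UniformSpace) (f : U -> R) x :
  continuous f x -> continuous (fun y => - f y) x.
Proof. by move=> hf; exact: (continuous_opp f x hf). Qed.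

Lemma continuous_Rminus (U : UniformSpace) (f g : U -> R) x :
  continuous f x -> continuous g x -> continuous (fun y => f y - g y) x.
Proof. by move=> hf hg; apply: continuous_Rplus => //; exact: continuous_Ropp. Qed.

Lemma continuous_Rmult (U : UniformSpace) (f g : U -> R) x :
  continuous f x -> continuous g x -> continuous (fun y => f y * g y) x.
Proof. by move=> hf hg; exact: (continuous_mult f g x hf hg). Qed.

Lemma continuousE (f : R -> R) x :
  continuous f x <-> (forall eps, 0 < eps -> exists2 delta, 0 < delta &
     forall y, Rabs (y - x) < delta -> Rabs (f y - f x) < eps).
Proof.
split=> [/filterlim_locally hf eps heps | hf].
  by have [d hd] := hf (mkposreal eps heps); exists d; [exact: cond_pos|].
apply/filterlim_locally => -[eps heps]; have [d hd hy] := hf eps heps.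
by exists (mkposreal d hd) => y; exact: hy.
Qed.

Lemma continuous_ex_RInt (f : R -> R) a b :
  (forall x, continuous f x) -> ex_RInt f a b.
Proof. by move=> hf; apply: ex_RInt_continuous. Qed.

Lemma is_derive_RInt_continuous (f : R -> R) a b :
  (forall x, continuous f x) -> is_derive (fun x => RInt f a x) b (f b).
Proof.
move=> hf; apply: (is_derive_RInt f _ a b); last exact: hf.
by exists (mkposreal 1 Rlt_0_1) => y _; apply/RInt_correct/continuous_ex_RInt.
Qed.

Lemma continuous_RInt_upper (f : R -> R) a b :
  (forall x, continuous f x) -> continuous (fun x => RInt f a x) b.
Proof.
by move=> hf; apply: (ex_derive_continuous (V := R_NormedModule));
   exists (f b); exact: is_derive_RInt_continuous.
Qed.

Lemma is_derive_continuous (f : R -> R) x l : is_derive f x l -> continuous f x.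
Proof.
by move=> hf; apply: (ex_derive_continuous (V := R_NormedModule)); exists l.
Qed.

(** If [w b > 0], let [m] be the last point with [w m <= 0]. Beyond it [w] is positive, hence
    nonincreasing, so it cannot have risen to [w b]. *)
Lemma nonpos_barrier (w : R -> R) a b :
  a <= b -> (forall u, a <= u <= b -> continuous w u) -> w a <= 0 ->
  (forall u, a < u < b -> 0 < w u -> exists l, is_derive w u l /\ l <= 0) ->
  w b <= 0.
Proof.
move=> hab hc ha hd; apply: Rnot_lt_le => hb.
pose E u := a <= u <= b /\ w u <= 0.
have [m [hub hlub]] : {m | is_lub E m}.
  apply: completeness; first by exists b => u [[]].
  by exists a; split=> //; lra.
have ham : a <= m by apply: hub; split=> //; lra.
have hmb : m <= b by apply: hlub => u [[]].
have hm : w m <= 0.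
  apply: Rnot_lt_le => hm.
  have [|d hd0 hwd] := (proj1 (continuousE w m)) _ (w m) hm; first exact: hc.
  suff : m <= m - d by lra.
  apply: hlub => u [hu hwu]; apply: Rnot_lt_le => hlt.
  have hum : u <= m by apply: hub.
  have := hwd u; rewrite !Rabs_left1; try lra.
have hmb' : m < b by case: (Req_dec m b) => [e|]; [move: hm; rewrite e|]; lra.
have hpos u : m < u <= b -> 0 < w u.
  move=> hu; apply: Rnot_le_lt => hwu.
  suff : u <= m by lra.
  by apply: hub; split=> //; lra.
(* The mean point may be an endpoint, where [Derive w] can be junk; the cap at 0 gives the sign
   there too. *)
have [||c [_ hc']] := @MVT_gen w m b (fun x => Rmin (Derive w x) 0).
- rewrite Rmin_left ?Rmax_right; try lra; move=> x hx.
  have [||l [hl hl0]] := hd x; [lra | apply: hpos; lra |].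
  by rewrite (is_derive_unique _ _ _ hl) Rmin_left.
- rewrite Rmin_left ?Rmax_right; try lra; move=> x hx.
  by apply/continuity_pt_filterlim/hc; lra.
have := Rmin_r (Derive w c) 0; nra.
Qed.

Lemma nonpos_barrier_left (w : R -> R) a b :
  a <= b -> (forall u, a <= u <= b -> continuous w u) -> w b <= 0 ->
  (forall u, a < u < b -> 0 < w u -> exists l, is_derive w u l /\ 0 <= l) ->
  w a <= 0.
Proof.
move=> hab hc hb hd.
rewrite -[a]Ropp_involutive.
apply: (@nonpos_barrier (fun s => w (- s)) (- b) (- a)); first lra.
- move=> u hu; apply: (continuous_comp Ropp w); last by apply: hc; lra.
  by apply: continuous_Ropp; exact: continuous_id.
- by rewrite Ropp_involutive.
- move=> u hu hw; have [||l [hl hl0]] := hd (- u) => //; first lra.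
  exists (- l); split; last lra.
  have -> : - l = scal (-1) l by rewrite /scal /= /mult /=; ring.
  apply: (is_derive_comp w) => //.
  by auto_derive => //; ring.
Qed.

(** * Solutions of [y' = G - c slope y] *)

(* If [q = p ^ 2 / 2] is the kinetic energy of a profile, [slope q] is
   its momentum [p]. *)
Definition slope (q : R) : R := sqrt (2 * Rmax q 0).

Lemma slope_ge0 q : 0 <= slope q.
Proof. exact: sqrt_pos. Qed.

Lemma slope_le0 q : q <= 0 -> slope q = 0.
Proof. by move=> hq; rewrite /slope Rmax_right // Rmult_0_r sqrt_0. Qed.

Lemma slope_sqr q : 0 <= q -> slope q * slope q = 2 * q.
Proof. by move=> hq; rewrite /slope Rmax_left // sqrt_def //; lra. Qed.

Lemma slope_gt0 q : 0 < q -> 0 < slope q.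
Proof. by move=> hq; apply: sqrt_lt_R0; rewrite Rmax_left; lra. Qed.

Lemma slope_le a b : a <= b -> slope a <= slope b.
Proof.
by move=> hab; apply: sqrt_le_1_alt; have := Rle_max_compat_r _ _ 0 hab; lra.
Qed.

(** For [a > b > 0], squaring leaves only a nonnegative cross term. The resulting Hölder modulus of
    exponent 1/2 stands in for a Lipschitz constant. *)
Lemma slope_subadd a b : slope a <= slope b + slope (Rabs (a - b)).
Proof.
case: (Rle_lt_dec a b) => hab.
  by have := slope_le hab; have := slope_ge0 (Rabs (a - b)); lra.
rewrite Rabs_pos_eq; last lra.
case: (Rle_lt_dec b 0) => hb.
  by rewrite (slope_le0 hb) Rplus_0_l; apply: slope_le; lra.
have h1 : slope b * slope b = 2 * b by apply: slope_sqr; lra.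
have h2 : slope a * slope a = 2 * a by apply: slope_sqr; lra.
have h3 : slope (a - b) * slope (a - b) = 2 * (a - b) by apply: slope_sqr; lra.
have := slope_ge0 a; have := slope_ge0 b; have := slope_ge0 (a - b).
move=> *; apply: Rsqr_incr_0; rewrite /Rsqr; nra.
Qed.

Lemma slope_dist a b : Rabs (slope a - slope b) <= slope (Rabs (a - b)).
Proof.
have := slope_subadd a b; have := slope_subadd b a.
by rewrite (Rabs_minus_sym b a) => *; apply: Rabs_le; lra.
Qed.

Lemma continuous_slope (U : UniformSpace) (f : U -> R) x :
  continuous f x -> continuous (fun y => slope (f y)) x.
Proof.
move=> hf; apply: (continuous_comp f slope) => //.
apply: (continuous_sqrt_comp (fun q => 2 * Rmax q 0)).
apply/continuousE => eps heps; exists (eps / 2) => [|y]; first lra.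
rewrite -Rmult_minus_distr_l Rabs_mult (Rabs_pos_eq 2); last lra.
move=> hy; suff : Rabs (Rmax y 0 - Rmax (f x) 0) <= Rabs (y - f x) by lra.
by rewrite /Rmax /Rabs; case: (Rle_dec y 0) => ?; case: (Rle_dec (f x) 0) => ?;
   repeat case: (Rcase_abs _) => ?; lra.
Qed.

Lemma slope_small eps : 0 < eps -> exists2 delta, 0 < delta &
  forall a, a < delta -> slope a < eps.
Proof.
move=> heps; exists (eps * eps / 2) => [|a ha]; first nra.
case: (Rle_lt_dec a 0) => ha0; first by rewrite slope_le0.
have := slope_sqr (Rlt_le _ _ ha0); have := slope_ge0 a; nra.
Qed.

(* Tonelli's scheme for [y' = G - c slope y]: the delay [e] makes the
   Picard iterates stationary after finitely many steps on bounded sets. *)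
Fixpoint delayed (G : R -> R) (c e : R) (n : nat) : R -> R :=
  match n with
  | O => fun _ => 0
  | n'.+1 => fun s =>
      RInt (fun t => G t - c * slope (delayed G c e n' (t - e))) 0 s
  end.

Lemma continuous_delayed G c e n s :
  (forall t, continuous G t) -> continuous (delayed G c e n) s.
Proof.
move=> hG; elim: n s => [|n IH] s; first exact: continuous_const.
apply: continuous_RInt_upper => t; apply: continuous_Rminus => //.
apply: continuous_Rmult; first exact: continuous_const.
apply: continuous_slope; apply: (continuous_comp (fun t => t - e)) => //.
by apply: continuous_Rminus; [exact: continuous_id | exact: continuous_const].
Qed.

Lemma is_derive_delayed G c e n s :
  (forall t, continuous G t) ->
  is_derive (delayed G c e n.+1) s (G s - c * slope (delayed G c e n (s - e))).
Proof.
move=> hG; apply: (is_derive_RInt_continuous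
  (f := fun t => G t - c * slope (delayed G c e n (t - e)))) => t.
apply: continuous_Rminus => //; apply: continuous_Rmult.
  exact: continuous_const.
apply: continuous_slope; apply: (continuous_comp (fun t => t - e)).
  by apply: continuous_Rminus; [exact: continuous_id | exact: continuous_const].
exact: continuous_delayed.
Qed.

Lemma delayed_le0 G c e n s : 0 <= e -> (forall t, t <= 0 -> G t = 0) ->
  s <= 0 -> delayed G c e n s = 0.
Proof.
move=> he hG; elim: n s => [//|n IH] s hs /=.
rewrite (RInt_ext _ (fun _ => 0)) ?RInt_const; last first.
  move=> x; rewrite Rmax_left // => hx; rewrite hG ?IH; try lra.
  by rewrite slope_le0; lra.
by rewrite /scal /= /mult /= Rmult_0_r.
Qed.

(** Level [n.+1] at [s] reads level [n] only up to [s - e], so each iteration makes a further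
    stretch of length [e] final. *)
Lemma delayed_stationary G c e n s : 0 <= e -> (forall t, t <= 0 -> G t = 0) ->
  s <= INR n * e -> delayed G c e n.+1 s = delayed G c e n s.
Proof.
move=> he hG; elim: n s => [|n IH] s hs.
  by rewrite delayed_le0 //; move: hs; rewrite Rmult_0_l.
apply: RInt_ext => x hx; congr (_ - c * slope _); apply: IH.
move: hs hx; rewrite S_INR => hs; have := pos_INR n => hn.
rewrite /Rmax; case: (Rle_dec 0 s) => *; nra.
Qed.

Lemma exists_delayed_solution G c e (N : nat) : 0 <= e -> 1 <= INR N * e ->
  (forall t, continuous G t) -> (forall t, t <= 0 -> G t = 0) ->
  exists y : R -> R, [/\ forall s, continuous y s, forall s, s <= 0 -> y s = 0 &
    forall s, s <= 1 -> is_derive y s (G s - c * slope (y (s - e)))].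
Proof.
move=> he hN hG hG0; exists (delayed G c e N.+1); split.
- by move=> s; exact: continuous_delayed.
- by move=> s; exact: delayed_le0.
- move=> s hs; have -> : delayed G c e N.+1 (s - e) = delayed G c e N (s - e).
    by apply: delayed_stationary => //; lra.
  exact: is_derive_delayed.
Qed.

Definition delayed_solution (G : R -> R) (c e : R) (y : R -> R) : Prop :=
  [/\ forall s, continuous y s, forall s, s <= 0 -> y s = 0 &
      forall s, s <= 1 -> is_derive y s (G s - c * slope (y (s - e)))].

(** Damping only lowers [y], so [y] stays below [B * s]. As [slope] vanishes on negative values,
    this one-sided bound already controls the damping term. *)
Lemma delayed_solution_le G c e y B s : 0 <= c -> (forall t, Rabs (G t) <= B) ->
  delayed_solution G c e y -> s <= 1 -> y s <= B.
Proof.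
move=> hc hG [hy hy0 hd] hs.
have hB : 0 <= B by have := hG 0; have := Rabs_pos (G 0); lra.
case: (Rle_lt_dec s 0) => hs0; first by rewrite hy0.
suff : y s - B * s <= 0 by nra.
apply: (@nonpos_barrier (fun t => y t - B * t) 0 s); first lra.
- move=> u _; apply: continuous_Rminus => //; apply: continuous_Rmult.
    exact: continuous_const.
  exact: continuous_id.
- by rewrite hy0; lra.
- move=> u hu _; exists ((G u - c * slope (y (u - e))) - B); split.
    apply: (is_derive_minus y (fun t => B * t)); first by apply: hd; lra.
    by auto_derive => //; ring.
  have := slope_ge0 (y (u - e)); have := hG u.
  by move=> /Rabs_le_between; nra.
Qed.

Lemma delayed_solution_shift G c e y B s : 0 <= c -> 0 <= e ->
  (forall t, Rabs (G t) <= B) -> delayed_solution G c e y -> s <= 1 ->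
  Rabs (slope (y s) - slope (y (s - e))) <= slope ((B + c * slope B) * e).
Proof.
move=> hc he hG hy hs; apply: Rle_trans (slope_dist _ _) _; apply: slope_le.
have [hyc _ hd] := hy.
have [||t [_ ->]] := @MVT_gen y (s - e) s
    (* The location of the mean point is dropped; the cutoff makes the bound on the derivative hold
       at every [t]. *)
    (fun t => if Rle_dec t 1 then G t - c * slope (y (t - e)) else 0).
- rewrite Rmin_left ?Rmax_right; try lra; move=> x hx.
  by case: (Rle_dec x 1) => *; [apply: hd | lra].
- by move=> x _; exact/continuity_pt_filterlim/hyc.
rewrite Rabs_mult (Rabs_pos_eq (s - (s - e))); last lra.
have -> : s - (s - e) = e by ring.
apply: Rmult_le_compat_r => //.
have := slope_ge0 B; have := hG t; have := Rabs_pos (G t).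
case: (Rle_dec t 1) => ht; last by rewrite Rabs_R0; nra.
move=> h1 /Rabs_le_between h2 h3; apply: Rabs_le.
have : slope (y (t - e)) <= slope B.
  by apply/slope_le/(delayed_solution_le hc hG hy); lra.
by have := slope_ge0 (y (t - e)); nra.
Qed.

(** Where [y1 > y2], monotonicity of [slope] gives the undelayed damping terms the right sign. Only
    the two delay errors can drive the gap, and they add up over a time at most 1. *)
Lemma delayed_solution_cauchy G c e1 e2 y1 y2 B s : 0 <= c ->
  0 <= e1 -> 0 <= e2 -> (forall t, Rabs (G t) <= B) ->
  delayed_solution G c e1 y1 -> delayed_solution G c e2 y2 -> s <= 1 ->
  y1 s - y2 s <= c * slope ((B + c * slope B) * e1)
                 + c * slope ((B + c * slope B) * e2).
Proof.
move=> hc he1 he2 hG hy1 hy2 hs.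
set k1 := slope (_ * e1); set k2 := slope (_ * e2).
have hk1 : 0 <= k1 by exact: slope_ge0.
have hk2 : 0 <= k2 by exact: slope_ge0.
have [c1 z1 d1] := hy1; have [c2 z2 d2] := hy2.
case: (Rle_lt_dec s 0) => hs0; first by rewrite z1 // z2 //; nra.
suff : y1 s - y2 s - (c * k1 + c * k2) * s <= 0.
  by move: (Rmult_le_pos _ _ hc hk1) (Rmult_le_pos _ _ hc hk2); nra.
apply: (@nonpos_barrier (fun t => y1 t - y2 t - (c * k1 + c * k2) * t) 0 s).
- lra.
- move=> u _; apply: continuous_Rminus; first exact: continuous_Rminus.
  by apply: continuous_Rmult; [exact: continuous_const | exact: continuous_id].
- by rewrite z1 ?z2; lra.
- move=> u hu hw.
  exists ((G u - c * slope (y1 (u - e1))) - (G u - c * slope (y2 (u - e2)))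
          - (c * k1 + c * k2)); split.
    apply: (is_derive_minus (fun t => y1 t - y2 t) (fun t => (c * k1 + c * k2) * t)).
      by apply: (is_derive_minus y1 y2); [apply: d1 | apply: d2]; lra.
    by auto_derive => //; ring.
  have /Rabs_le_between h1 :
      Rabs (slope (y1 u) - slope (y1 (u - e1))) <= k1.
    by apply: (delayed_solution_shift hc he1 hG hy1); lra.
  have /Rabs_le_between h2 :
      Rabs (slope (y2 u) - slope (y2 (u - e2))) <= k2.
    by apply: (delayed_solution_shift hc he2 hG hy2); lra.
  have h3 : slope (y2 u) <= slope (y1 u).
    by apply: slope_le; move: (Rmult_le_pos _ _ hc hk1) (Rmult_le_pos _ _ hc hk2); nra.
  by nra.
Qed.

Lemma uniform_cauchy_limit (Y : nat -> R -> R) (eta : nat -> R) :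
  is_lim_seq eta 0 ->
  (forall n m s, Rabs (Y n s - Y m s) <= eta n + eta m) ->
  exists y : R -> R, forall n s, Rabs (Y n s - y s) <= eta n.
Proof.
move=> he hY.
exists (fun s => real (Lim_seq (fun n => Y n s))) => n s.
have [l hl] : ex_finite_lim_seq (fun n => Y n s).
  apply/ex_lim_seq_cauchy_corr => -[eps heps] /=.
  move/is_lim_seq_spec: he => he.
  have [N hN] := he (mkposreal (eps / 2) ltac:(lra)).
  exists N => i j hi hj.
  apply: Rle_lt_trans (hY _ _ _) _.
  have := hN i hi; have := hN j hj => /=; rewrite !Rminus_0_r.
  by move=> /Rabs_lt_between ? /Rabs_lt_between ?; lra.
rewrite (is_lim_seq_unique _ _ hl) /=.
have h1 : is_lim_seq (fun m => Rabs (Y n s - Y m s)) (Rabs (Y n s - l)).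
  apply: (is_lim_seq_abs _ (Finite (Y n s - l))).
  by apply: is_lim_seq_minus'; [exact: is_lim_seq_const | ].
have h2 : is_lim_seq (fun m => eta n + eta m) (eta n + 0).
  by apply: is_lim_seq_plus' => //; exact: is_lim_seq_const.
have := is_lim_seq_le _ _ _ _ (fun m => hY n m s) h1 h2.
by rewrite /= Rplus_0_r.
Qed.

Lemma uniform_limit_continuous (Y : nat -> R -> R) (eta : nat -> R) y s :
  is_lim_seq eta 0 -> (forall n t, Rabs (Y n t - y t) <= eta n) ->
  (forall n t, continuous (Y n) t) -> continuous y s.
Proof.
move=> he hY hc; apply/continuousE => eps heps.
move/is_lim_seq_spec: he => he.
have [N hN] := he (mkposreal (eps / 3) ltac:(lra)).
have {hN} := hN N (le_n _); rewrite /= Rminus_0_r => /Rabs_lt_between hN.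
have [|d hd hd'] := (proj1 (continuousE (Y N) s)) (hc N s) (eps / 3); first lra.
exists d => // t ht; have := hd' t ht; have := hY N s; have := hY N t.
move=> /Rabs_le_between h1 /Rabs_le_between h2 /Rabs_lt_between h3.
by apply/Rabs_lt_between; lra.
Qed.

Lemma exists_dissipative_solution (G : R -> R) (c B : R) : 0 <= c ->
  (forall t, continuous G t) -> (forall t, t <= 0 -> G t = 0) ->
  (forall t, Rabs (G t) <= B) ->
  exists y : R -> R, [/\ forall s, continuous y s, y 0 = 0 &
    forall s, 0 < s < 1 -> is_derive y s (G s - c * slope (y s))].
Proof.
move=> hc hGc hG0 hGB.
pose e n := / INR n.+1.
have he n : 0 < e n by apply/Rinv_0_lt_compat/lt_0_INR/PeanoNat.Nat.lt_0_succ.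
have [Y hY] : exists Y : nat -> R -> R, forall n, delayed_solution G c (e n) (Y n).
  apply: (choice (fun n y => delayed_solution G c (e n) y)) => n.
  apply: (@exists_delayed_solution G c (e n) n.+1) => //.
    exact/Rlt_le/he.
  by rewrite Rinv_r; [lra | exact/not_0_INR].
pose k n := slope ((B + c * slope B) * e n).
have hk : is_lim_seq k 0.
  apply/is_lim_seq_spec => -[eps heps] /=.
  have [d hd hd'] := slope_small heps.
  have : is_lim_seq (fun n => (B + c * slope B) * e n) ((B + c * slope B) * 0).
    apply: (is_lim_seq_scal_l e (B + c * slope B) 0).
    rewrite -/(Rbar_inv p_infty).
    apply: (is_lim_seq_inv (fun n => INR n.+1) p_infty) => //.
    by apply/(is_lim_seq_incr_1 INR)/is_lim_seq_INR.
  rewrite Rmult_0_r => /is_lim_seq_spec /(_ (mkposreal d hd)) [N hN].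
  exists N => n hn; rewrite Rminus_0_r Rabs_pos_eq; last exact: slope_ge0.
  by apply: hd'; have := hN n hn => /=; rewrite Rminus_0_r => /Rabs_lt_between; lra.
have hck : is_lim_seq (fun n => c * k n) 0.
  by rewrite -(Rmult_0_r c); exact: (is_lim_seq_scal_l k c 0).
(* The Cauchy estimate holds up to time 1; freezing [Y n] after 1 makes it hold on the whole
   line. *)
have [||y hy] := @uniform_cauchy_limit (fun n s => Y n (Rmin s 1))
    (fun n => c * k n) => //.
  move=> n m s; have hs := Rmin_r s 1; apply: Rabs_le.
  have hn := Rlt_le _ _ (he n); have hm := Rlt_le _ _ (he m).
  have h1 := delayed_solution_cauchy hc hn hm hGB (hY n) (hY m) hs.
  have h2 := delayed_solution_cauchy hc hm hn hGB (hY m) (hY n) hs.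
  by rewrite -!/(k _) in h1 h2; lra.
have hyc s : continuous y s.
  apply: (uniform_limit_continuous hck hy) => n t.
  have [hYc _ _] := hY n.
  apply: (continuous_comp (fun s => Rmin s 1)) => //.
  apply/continuousE => eps heps; exists eps => // x.
  by rewrite /Rmin; case: (Rle_dec x 1) => ?; case: (Rle_dec t 1) => ?;
    rewrite /Rabs; repeat case: (Rcase_abs _) => ?; lra.
have hy0 : y 0 = 0.
  have h n : Rabs (y 0) <= c * k n.
    have := hy n 0; rewrite Rmin_left; last lra.
    have [_ hY0 _] := hY n; rewrite hY0; last lra.
    by rewrite Rminus_0_l Rabs_Ropp.
  have := is_lim_seq_le _ _ _ _ h (is_lim_seq_const _) hck.
  by move=> /= h0; apply: Rabs_eq_0; have := Rabs_pos (y 0); lra.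
exists y; split=> //.
pose D t := G t - c * slope (y t).
have hD t : continuous D t.
  apply: continuous_Rminus => //; apply: continuous_Rmult.
    exact: continuous_const.
  exact: continuous_slope.
(* Uniform convergence does not carry derivatives to the limit, but it does carry the integral
   equation, which is differentiated afterwards. The integrands differ by the delay error plus
   [slope] of the uniform error. *)
have hint s : 0 <= s <= 1 -> y s = RInt D 0 s.
  move=> hs.
  have h n : Rabs (y s - RInt D 0 s) <= c * k n + c * (k n + slope (c * k n)).
    have [hYc hY0 hYd] := hY n.
    pose Dn t := G t - c * slope (Y n (t - e n)).
    have hDn t : continuous Dn t.
      apply: continuous_Rminus => //; apply: continuous_Rmult.
        exact: continuous_const.
      apply: continuous_slope; apply: (continuous_comp (fun t => t - e n)) => //.
      by apply: continuous_Rminus; [exact: continuous_id | exact: continuous_const].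
    have hYi : Y n s = RInt Dn 0 s.
      have /is_RInt_unique -> : is_RInt Dn 0 s (Y n s - Y n 0).
        apply: is_RInt_derive => // x; rewrite Rmin_left ?Rmax_right; try lra.
        by move=> hx; apply: hYd; lra.
      by rewrite (hY0 0); lra.
    have hdiff : Rabs (RInt Dn 0 s - RInt D 0 s) <=
        (s - 0) * (c * (k n + slope (c * k n))).
      rewrite -[RInt Dn 0 s - _]/(minus (RInt Dn 0 s) (RInt D 0 s)).
      rewrite -RInt_minus; try exact: continuous_ex_RInt.
      apply: abs_RInt_le_const; [lra | |].
        by apply: continuous_ex_RInt => x; exact: continuous_Rminus.
      move=> t ht; rewrite /minus /plus /opp /= /Dn /D.
      have -> : G t - c * slope (Y n (t - e n)) + - (G t - c * slope (y t)) =
        c * ((slope (Y n t) - slope (Y n (t - e n))) + (slope (y t) - slope (Y n t))).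
        ring.
      rewrite Rabs_mult (Rabs_pos_eq c) //; apply: Rmult_le_compat_l => //.
      apply: Rle_trans (Rabs_triang _ _) _; apply: Rplus_le_compat.
        by apply: (delayed_solution_shift hc (Rlt_le _ _ (he n)) hGB (hY n)); lra.
      apply: Rle_trans (slope_dist _ _) _; apply: slope_le.
      by have := hy n t; rewrite Rmin_left 1?Rabs_minus_sym; lra.
    have h1 : Rabs (Y n s - y s) <= c * k n.
      by have := hy n s; rewrite Rmin_left //; lra.
    have h2 : 0 <= c * (k n + slope (c * k n)).
      apply: Rmult_le_pos => //; have := slope_ge0 (c * k n).
      by have : 0 <= k n := slope_ge0 _; lra.
    rewrite hYi in h1.
    move: h1 hdiff => /Rabs_le_between h1 /Rabs_le_between hdiff.
    by apply: Rabs_le; nra.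
  have hlim : is_lim_seq (fun n => c * k n + c * (k n + slope (c * k n)))
      (0 + c * (0 + slope 0)).
    apply: is_lim_seq_plus' => //.
    apply: (is_lim_seq_scal_l _ c (Finite (0 + slope 0))).
    apply: is_lim_seq_plus' => //.
    apply: is_lim_seq_continuous => //.
    by apply/continuity_pt_filterlim/(continuous_slope (f := id)); exact: continuous_id.
  have := is_lim_seq_le _ _ _ _ h (is_lim_seq_const _) hlim.
  rewrite /= slope_le0; last lra.
  move=> h0; apply: Rminus_diag_uniq; apply: Rabs_eq_0.
  by have := Rabs_pos (y s - RInt D 0 s); lra.
move=> s hs; apply: (is_derive_ext_loc (fun t => RInt D 0 t));
  last exact: (is_derive_RInt_continuous (f := D)).
apply: (locally_interval _ s 0 1) => /=; try lra.
by move=> t /= h1 h2; rewrite hint //; lra.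
Qed.

(** * Orbits in the phase plane *)

Lemma is_derive_interior_min (q : R -> R) a b u l : is_derive q u l ->
  a < u < b -> (forall x, a < x < b -> q u <= q x) -> l = 0.
Proof.
move=> /is_derive_Reals hd hu hq.
have hpr : derivable_pt q u by exists l.
have := deriv_minimum q a b u hpr (proj1 hu) (proj2 hu).
rewrite (derive_pt_eq_0 _ _ _ hpr hd); apply=> x h1 h2.
by apply: hq.
Qed.

(* The phase-plane form of [phi'' + c phi' + g phi = 0] with
   [phi' = - slope (q phi)], issued from the equilibrium [1]. *)
Definition orbit (g : R -> R) (c : R) (q : R -> R) : Prop :=
  [/\ forall u, continuous q u, q 1 = 0 &
      forall u, 0 < u < 1 -> is_derive q u (c * slope (q u) - g u)].

Definition lipschitz01 (g : R -> R) (K : R) : Prop :=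
  0 <= K /\ forall u v, 0 <= u <= 1 -> 0 <= v <= 1 ->
    Rabs (g u - g v) <= K * Rabs (u - v).

Lemma lipschitz01_at0 g K u : lipschitz01 g K -> g 0 = 0 -> 0 <= u <= 1 ->
  Rabs (g u) <= K * u.
Proof.
move=> [hK hg] h0 hu; have := hg u 0 hu ltac:(lra).
by rewrite h0 !Rminus_0_r (Rabs_pos_eq u); lra.
Qed.

Lemma lipschitz01_at1 g K u : lipschitz01 g K -> g 1 = 0 -> 0 <= u <= 1 ->
  Rabs (g u) <= K * (1 - u).
Proof.
move=> [hK hg] h0 hu; have := hg u 1 hu ltac:(lra).
by rewrite h0 Rminus_0_r (Rabs_left1 (u - 1)); lra.
Qed.

Lemma exists_orbit g c K : 0 <= c -> (forall u, continuous g u) ->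
  lipschitz01 g K -> g 0 = 0 -> g 1 = 0 -> exists q, orbit g c q.
Proof.
move=> hc hg hK h0 h1.
(* The time [s = 1 - u] runs in the dissipative direction. Clamping makes the forcing bounded, and
   zero for [s <= 0] because [g 1 = 0]. *)
pose G s := g (Rmax 0 (Rmin 1 (1 - s))).
have hcl s : 0 <= Rmax 0 (Rmin 1 (1 - s)) <= 1.
  by split; [exact: Rmax_l | apply: Rmax_lub; [lra | exact: Rmin_l]].
have [||| y [hy hy0 hd]] := @exists_dissipative_solution G c K hc.
- move=> s; apply: (continuous_comp (fun s => Rmax 0 (Rmin 1 (1 - s)))) => //.
  apply/continuousE => eps heps; exists eps => // x.
  rewrite /Rmin; repeat case: (Rle_dec _ _) => ?; rewrite /Rmax;
    repeat case: (Rle_dec _ _) => ?; rewrite /Rabs;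
    by repeat case: (Rcase_abs _) => ?; lra.
- by move=> s hs; rewrite /G Rmin_left ?Rmax_right; lra.
- move=> s; have := lipschitz01_at0 hK h0 (hcl s); rewrite -/(G s).
  by have [hK0 _] := hK; have := hcl s; nra.
exists (fun u => y (1 - u)); split.
- move=> u; apply: (continuous_comp (fun u => 1 - u)) => //.
  by apply: continuous_Rminus; [exact: continuous_const | exact: continuous_id].
- by rewrite Rminus_diag.
- move=> u hu.
  have -> : c * slope (y (1 - u)) - g u = scal (-1) (G (1 - u) - c * slope (y (1 - u))).
    rewrite /G /scal /= /mult /=.
    have -> : 1 - (1 - u) = u by ring.
    by rewrite Rmin_right ?Rmax_right; try lra.
  apply: (is_derive_comp y); first by apply: hd; lra.
  by auto_derive => //; ring.
Qed.

(** Friction takes energy away on the way from 1 to 0, so the bound does not depend on [c]. *)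
Lemma orbit_upper_bound g c q K u : 0 <= c -> lipschitz01 g K -> g 0 = 0 ->
  orbit g c q -> 0 <= u <= 1 -> q u <= K * (1 - u).
Proof.
move=> hc hK h0 [hq hq1 hd] hu.
suff : q u - K * (1 - u) <= 0 by lra.
apply: (@nonpos_barrier_left (fun t => q t - K * (1 - t)) u 1); first lra.
- move=> t _; apply: continuous_Rminus => //; apply: (is_derive_continuous (l := - K)).
  by auto_derive => //; ring.
- by rewrite hq1; lra.
- move=> t ht _; exists (c * slope (q t) - g t - - K); split.
    apply: (is_derive_minus q (fun t => K * (1 - t))); first by apply: hd; lra.
    by auto_derive => //; ring.
  have := slope_ge0 (q t).
  have /(lipschitz01_at0 hK h0) /Rabs_le_between : 0 <= t <= 1 by lra.
  by have [hK0 _] := hK; nra.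
Qed.

Lemma orbit_slope_bound g c q K u : 0 <= c -> lipschitz01 g K -> g 0 = 0 ->
  orbit g c q -> 0 <= u <= 1 -> slope (q u) <= slope K.
Proof.
move=> hc hK h0 hq hu; apply: slope_le.
by have := orbit_upper_bound hc hK h0 hq hu; have [hK0 _] := hK; nra.
Qed.

(** Where [q1 > q2], monotonicity of [slope] bounds the derivative of [q1 - q2] below by
    [- (c2 - c1) * slope (q2 t)], and [slope K] bounds that momentum for every speed. *)
Lemma orbit_lipschitz_speed g K c1 c2 q1 q2 u : lipschitz01 g K -> g 0 = 0 ->
  0 <= c1 <= c2 -> orbit g c1 q1 -> orbit g c2 q2 -> 0 <= u <= 1 ->
  q1 u <= q2 u + (c2 - c1) * slope K.
Proof.
move=> hK h0 hc o1 o2 hu; have [hq1 e1 d1] := o1; have [hq2 e2 d2] := o2.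
have hs := slope_ge0 K.
suff : q1 u - q2 u - (c2 - c1) * slope K * (1 - u) <= 0.
  by have : 0 <= (c2 - c1) * slope K; [apply: Rmult_le_pos; lra | nra].
apply: (@nonpos_barrier_left
  (fun t => q1 t - q2 t - (c2 - c1) * slope K * (1 - t)) u 1); first lra.
- move=> t _; apply: continuous_Rminus; first exact: continuous_Rminus.
  apply: (is_derive_continuous (l := - ((c2 - c1) * slope K))).
  by auto_derive => //; ring.
- by rewrite e1 e2; lra.
- move=> t ht hw; exists (c1 * slope (q1 t) - g t - (c2 * slope (q2 t) - g t)
                         - - ((c2 - c1) * slope K)); split.
    apply: (is_derive_minus (fun t => q1 t - q2 t)).
      by apply: (is_derive_minus q1 q2); [apply: d1 | apply: d2]; lra.
    by auto_derive => //; ring.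
  have h1 : slope (q2 t) <= slope (q1 t).
    apply: slope_le.
    by have : 0 <= (c2 - c1) * slope K; [apply: Rmult_le_pos; lra | nra].
  have h2 : slope (q2 t) <= slope K.
    by apply: (orbit_slope_bound _ hK h0 o2); lra.
  by nra.
Qed.

(** Kinetic plus potential energy, corrected by the work of friction, has zero derivative in [u]. *)
Lemma orbit_energy g c q u : (forall v, continuous g v) -> orbit g c q ->
  0 <= u <= 1 ->
  q u + primitive g u - c * RInt (fun v => slope (q v)) 0 u =
  primitive g 1 - c * RInt (fun v => slope (q v)) 0 1.
Proof.
move=> hg [hq hq1 hd] hu.
pose p v := slope (q v).
have hp v : continuous p v by apply: continuous_slope; exact: hq.
pose W v := q v + primitive g v - c * RInt p 0 v.
have [||t [_]] := @MVT_gen W u 1 (fun _ => 0).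
- rewrite Rmin_left ?Rmax_right; try lra; move=> x hx.
  have -> : 0 = c * p x - g x + g x - c * p x by ring.
  apply: (is_derive_minus (fun v => q v + primitive g v) (fun v => c * RInt p 0 v)).
    apply: (is_derive_plus q (primitive g)); first by apply: hd; lra.
    exact: (is_derive_RInt_continuous (f := g)).
  apply: (is_derive_scal (fun v => RInt p 0 v)).
  exact: (is_derive_RInt_continuous (f := p)).
- move=> x _; apply/continuity_pt_filterlim/continuous_Rminus.
    apply: continuous_Rplus; first exact: hq.
    exact: (continuous_RInt_upper (f := g)).
  apply: continuous_Rmult; first exact: continuous_const.
  exact: (continuous_RInt_upper (f := p)).
by rewrite /W hq1 /p; lra.
Qed.

Lemma orbit_slope_derive g c q u : orbit g c q -> 0 < u < 1 -> 0 < q u ->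
  is_derive (fun v => slope (q v)) u (c - g u / slope (q u)).
Proof.
move=> [hq _ hd] hu hqu.
have hp := slope_gt0 hqu.
have -> : c - g u / slope (q u) =
    2 * (c * slope (q u) - g u) / (2 * sqrt (2 * q u)).
  have -> : sqrt (2 * q u) = slope (q u) by rewrite /slope Rmax_left //; lra.
  by field; lra.
apply: (is_derive_ext_loc (fun v => sqrt (2 * q v))).
  have [d hd0 hd'] := (proj1 (continuousE q u)) (hq u) _ hqu.
  exists (mkposreal d hd0) => y /hd' /Rabs_lt_between hy.
  by rewrite /slope Rmax_left //; lra.
apply: is_derive_sqrt; last lra.
by apply: is_derive_scal; exact: hd.
Qed.

(** A maximum of [primitive g] on [0, 1] at an interior point would have a value above
    [primitive g 0], so (b) would give [g > 0] there, while an interior maximum forces [g = 0].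
    Hence 1 is the only maximum point. *)
Lemma condition_b_lt g u : (forall v, continuous g v) -> condition_b g ->
  0 <= u < 1 -> primitive g u < primitive g 1.
Proof.
move=> hg [hF hb] hu.
have F0 : primitive g 0 = 0 by rewrite /primitive RInt_point.
have hc v : continuity_pt (primitive g) v.
  by apply/continuity_pt_filterlim; exact: (continuous_RInt_upper (f := g)).
have [m [hm hm01]] := continuity_ab_maj (primitive g) 0 1 Rle_0_1 (fun v _ => hc v).
have hnot v : 0 <= v < 1 -> primitive g m <= primitive g v -> False.
  move=> hv hle.
  have hv1 : 0 < primitive g v by have := hm 1; lra.
  have hv0 : 0 < v by case: (Req_dec v 0) => [e|]; [rewrite e F0 in hv1|]; lra.
  suff : - g v = 0 by have := hb v; lra.
  apply: (is_derive_interior_min (q := fun t => - primitive g t) (u := v) (a := 0) (b := 1)).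
  - by apply: (is_derive_opp (primitive g)); exact: (is_derive_RInt_continuous (f := g)).
  - lra.
  - by move=> x hx; have := hm x; lra.
have hm1 : m = 1.
  case: (Req_dec m 1) => // h; case: (hnot m); lra.
by rewrite -hm1; apply: Rnot_le_lt => h; apply: (hnot u).
Qed.

(** Where [q < 0] friction is off and [q' = - g < 0], so [q] increases towards the left and cannot
    have dropped below 0. A zero would then be an interior minimum, again with [q' = - g < 0]. *)
Lemma orbit_pos_near1 g c q a : orbit g c q ->
  0 <= a < 1 -> (forall u, a < u < 1 -> 0 < g u) ->
  forall u, a < u < 1 -> 0 < q u.
Proof.
move=> [hq hq1 hd] ha hg u hu.
have hge v : a < v <= 1 -> 0 <= q v.
  move=> hv; suff : - q v <= 0 by lra.
  apply: (@nonpos_barrier_left (fun t => - q t) v 1); first lra.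
  - by move=> t _; exact: continuous_Ropp.
  - by rewrite hq1; lra.
  - move=> t ht hw; exists (- (c * slope (q t) - g t)); split.
      by apply: (is_derive_opp q); apply: hd; lra.
    by rewrite slope_le0; [have := hg t | ]; lra.
have := hge u; case: (Rle_lt_dec (q u) 0) => // hle hge0.
suff : c * slope (q u) - g u = 0.
  by rewrite slope_le0 //; have := hg u; lra.
apply: (is_derive_interior_min (q := q) (u := u) (a := a) (b := 1)) => //.
  by apply: hd; lra.
by move=> x hx; have := hge x; lra.
Qed.

(** The line of slope 1 through 0 is a barrier for the momentum [p]: where [p > u], the bound
    [g u <= K * u] gives [p' = c - g / p >= 1] once [c >= K + 1]. So [p <= u] on the way down from
    1, and [p] cannot be positive at 0. *)
Lemma positive_orbit_speed_lt g c q K : lipschitz01 g K -> g 0 = 0 ->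
  orbit g c q -> (forall u, 0 <= u < 1 -> 0 < q u) -> c < K + 1.
Proof.
move=> hK h0 hq hpos; have [hqc hq1 _] := hq; apply: Rnot_le_lt => hc.
suff : slope (q 0) - 0 <= 0 by have := slope_gt0 (hpos 0 ltac:(lra)); lra.
apply: (@nonpos_barrier_left (fun u => slope (q u) - u) 0 1); first lra.
- move=> u _; apply: continuous_Rminus; last exact: continuous_id.
  by apply: continuous_slope; exact: hqc.
- by rewrite hq1 slope_le0; lra.
- move=> u hu hw; exists (c - g u / slope (q u) - 1); split.
    apply: (is_derive_minus (fun v => slope (q v)) (fun v => v)).
      by apply: orbit_slope_derive => //; apply: hpos; lra.
    exact: is_derive_id.
  have /(lipschitz01_at0 hK h0) /Rabs_le_between hgu : 0 <= u <= 1 by lra.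
  suff : g u / slope (q u) <= K by lra.
  apply: (Rmult_le_reg_r (slope (q u))); first lra.
  have [hK0 _] := hK.
  by rewrite /Rdiv Rmult_assoc Rinv_l; [nra | lra].
Qed.

(** * The critical speed *)

Definition positive_speed (g : R -> R) (c : R) : Prop :=
  0 <= c /\ exists2 q, orbit g c q & forall u, 0 <= u < 1 -> 0 < q u.

Lemma positive_near_one g : (forall v, continuous g v) -> condition_b g ->
  exists2 a, 0 < a < 1 & forall u, a < u < 1 -> 0 < g u.
Proof.
move=> hg [hF hb].
have F0 : primitive g 0 = 0 by rewrite /primitive RInt_point.
have [d hd0 hd] := (proj1 (continuousE (primitive g) 1))
  (continuous_RInt_upper (a := 0) (b := 1) hg) _ hF.
exists (Rmax (1 / 2) (1 - d)) => [|u hu].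
  by rewrite /Rmax; case: (Rle_dec _ _); lra.
have := Rmax_l (1 / 2) (1 - d); have := Rmax_r (1 / 2) (1 - d) => h1 h2.
apply: hb; first lra.
by have := hd u; rewrite Rabs_left1; [move=> /(_ ltac:(lra)) /Rabs_lt_between|]; lra.
Qed.

(** Positivity is an open condition on the speed, so it fails at an upper bound of the positive
    speeds. Away from 1 the minimum of [q] is the margin for a perturbation; near 1 there is none,
    and the sign of [g] does the work. *)
Lemma critical_orbit_zero g c q K : (forall v, continuous g v) ->
  lipschitz01 g K -> g 0 = 0 -> g 1 = 0 -> condition_b g -> 0 <= c ->
  (forall c', positive_speed g c' -> c' <= c) -> orbit g c q ->
  exists2 u, 0 <= u < 1 & q u <= 0.
Proof.
move=> hg hK h0 h1 hb hc hub hq; have [hqc _ _] := hq.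
apply: NNPP => hno.
have hpos u : 0 <= u < 1 -> 0 < q u.
  by move=> hu; apply: Rnot_le_lt => hle; apply: hno; exists u.
have [a ha hga] := positive_near_one hg hb.
have [||m [hm hm01]] := @continuity_ab_min q 0 ((a + 1) / 2); first lra.
  by move=> x _; apply/continuity_pt_filterlim/hqc.
have hqm : 0 < q m by apply: hpos; lra.
have hs := slope_ge0 K.
(* Chosen so that the loss [e * slope K] stays below the minimum [q m]; the [+ 1] covers
   [slope K = 0]. *)
pose e := q m / (2 * (slope K + 1)).
have he : 0 < e by apply: Rdiv_lt_0_compat; lra.
have heK : e * slope K < q m.
  have : e * (2 * (slope K + 1)) = q m by rewrite /e; field; lra.
  by nra.
have hce : 0 <= c + e by lra.
have [q' hq'] := exists_orbit hce hg hK h0 h1.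
suff : c + e <= c by lra.
apply: hub; split; first lra.
exists q' => // u hu.
case: (Rle_lt_dec u ((a + 1) / 2)) => hua.
  have := orbit_lipschitz_speed (u := u) hK h0 (_ : 0 <= c <= c + e) hq hq'.
  by have := hm u ltac:(lra) => h2 h3; have := h3 ltac:(lra) ltac:(lra); lra.
by apply: (orbit_pos_near1 hq' (_ : 0 <= a < 1) hga); lra.
Qed.

(* At an interior zero [u1] of the critical orbit the energy balance forces
   both [q] and [g] to vanish on [0, u1]; there the positive orbits of lower
   speed have momentum of slope [c], hence cannot come close to [0] at [u1]. *)
Lemma critical_orbit_no_interior_zero g c q K u1 : (forall v, continuous g v) ->
  lipschitz01 g K -> g 0 = 0 -> condition_b g -> 0 < c ->
  (forall d, d < c -> exists2 c', d < c' <= c & positive_speed g c') ->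
  orbit g c q -> (forall u, 0 <= u <= 1 -> 0 <= q u) ->
  0 < u1 < 1 -> q u1 <= 0 -> False.
Proof.
move=> hg hK h0 [hF hb] hc happ hq hq0 hu1 hqu1.
have [hqc _ hd] := hq.
have F0 : primitive g 0 = 0 by rewrite /primitive RInt_point.
have hzero u : 0 < u < 1 -> q u <= 0 -> g u = 0.
  move=> hu hqu; suff : c * slope (q u) - g u = 0 by rewrite slope_le0 //; lra.
  apply: (is_derive_interior_min (q := q) (u := u) (a := 0) (b := 1)) => //.
    exact: hd.
  by move=> x hx; have := hq0 x; lra.
have hFu1 : primitive g u1 <= 0.
  apply: Rnot_lt_le => h; have := hzero _ hu1 hqu1.
  by have := hb _ hu1; lra.
pose p v := slope (q v); pose P u := RInt p 0 u.
have hp v : continuous p v by apply: continuous_slope; exact: hqc.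
have hPint a b : a <= b -> 0 <= RInt p a b.
  move=> hab; apply: RInt_ge_0 => //; first exact: continuous_ex_RInt.
  by move=> x _; exact: slope_ge0.
(* Comparing the energy balances at 0 and [u1] gives [q 0 + c * P u1 = q u1 + primitive g u1 <=
   0]. *)
have hP0 u : 0 <= u <= u1 -> P u <= 0.
  move=> hu.
  have := orbit_energy hg hq (_ : 0 <= u1 <= 1) => /(_ ltac:(lra)).
  have := orbit_energy hg hq (_ : 0 <= 0 <= 1) => /(_ ltac:(lra)).
  rewrite RInt_point F0 /zero /= -/p -/(P u1) => e1 e2.
  have hPu1 : P u1 <= 0 by have := hq0 0; have := hPint 0 u1; rewrite -/(P u1); nra.
  have := RInt_Chasles p 0 u u1 (continuous_ex_RInt _ _ hp) (continuous_ex_RInt _ _ hp).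
  by rewrite /plus /= -/(P u) -/(P u1); have := hPint u u1; lra.
have hqz u : 0 < u < u1 -> q u <= 0.
  move=> hu; apply: Rnot_lt_le => hqu.
  suff : p u = 0 by have := slope_gt0 hqu; rewrite /p; lra.
  apply: (is_derive_interior_min (q := P) (u := u) (a := 0) (b := u1)) => //.
    exact: (is_derive_RInt_continuous (f := p)).
  by move=> x hx; have := hP0 u; have := hPint 0 x; rewrite -/(P x); lra.
have hgz u : 0 < u < u1 -> g u = 0.
  by move=> hu; apply: hzero; [lra | exact: hqz].
have hcu : 0 < c * u1 / 2 by nra.
have [e he0 he] := slope_small hcu.
have hs := slope_ge0 K.
(* The speed must exceed [c / 2], so that the momentum at [u1] is at least [c' * u1 > c * u1 / 2],
   and be so close to [c] that [q' u1 < e], which forces it below [c * u1 / 2]. *)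
have [|c' hc' [hc'0 [q' hq' hpos']]] := happ (Rmax (c / 2) (c - e / (slope K + 1))).
  apply: Rmax_lub_lt; first lra.
  by have : 0 < e / (slope K + 1) by [apply: Rdiv_lt_0_compat; lra]; lra.
have := Rmax_l (c / 2) (c - e / (slope K + 1)).
have := Rmax_r (c / 2) (c - e / (slope K + 1)) => hr hl.
have hq'u1 : q' u1 < e.
  have := orbit_lipschitz_speed (u := u1) hK h0 (_ : 0 <= c' <= c) hq' hq.
  move=> /(_ ltac:(lra) ltac:(lra)) h.
  have : (c - c') * (slope K + 1) < e / (slope K + 1) * (slope K + 1).
    by apply: Rmult_lt_compat_r; lra.
  have -> : e / (slope K + 1) * (slope K + 1) = e by field; lra.
  by nra.
have hp' := he _ hq'u1.
have [hqc' _ _] := hq'.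
suff : c' * u1 - slope (q' u1) <= 0 by nra.
apply: (@nonpos_barrier (fun u => c' * u - slope (q' u)) 0 u1); first lra.
- move=> u _; apply: continuous_Rminus.
    by apply: continuous_Rmult; [exact: continuous_const | exact: continuous_id].
  by apply: continuous_slope; exact: hqc'.
- by have := slope_ge0 (q' 0); lra.
- move=> u hu _; exists (c' - (c' - g u / slope (q' u))); split.
    apply: (is_derive_minus (fun v => c' * v)); first by auto_derive => //; ring.
    by apply: orbit_slope_derive => //; [lra | apply: hpos'; lra].
  by rewrite hgz //; lra.
Qed.

Lemma exists_critical_orbit g K : (forall v, continuous g v) ->
  lipschitz01 g K -> g 0 = 0 -> g 1 = 0 -> condition_b g ->
  exists c q, [/\ 0 < c, orbit g c q, q 0 = 0 & forall u, 0 < u < 1 -> 0 < q u].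
Proof.
move=> hg hK h0 h1 hb.
have F0 : primitive g 0 = 0 by rewrite /primitive RInt_point.
(* Without friction the energy balance reads [q u = primitive g 1 - primitive g u]. *)
have hrest q u : orbit g 0 q -> 0 <= u < 1 -> 0 < q u.
  move=> hq hu; have := orbit_energy hg hq (_ : 0 <= u <= 1) => /(_ ltac:(lra)).
  by have := condition_b_lt hg hb hu; lra.
have hS0 : positive_speed g 0.
  have [q hq] := exists_orbit (Rle_refl 0) hg hK h0 h1.
  by split; [lra | exists q => // u; exact: hrest].
have [c [hub hlub]] : {c | is_lub (positive_speed g) c}.
  apply: completeness; last by exists 0.
  exists (K + 1) => c [_ [q hq hpos]].
  by have := positive_orbit_speed_lt hK h0 hq hpos; lra.
have hc0 : 0 <= c by exact: hub.
have happ d : d < c -> exists2 c', d < c' <= c & positive_speed g c'.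
  move=> hdc; apply: NNPP => hno.
  suff : c <= d by lra.
  apply: hlub => c' hc'; apply: Rnot_lt_le => hlt.
  by apply: hno; exists c' => //; have := hub c' hc'; lra.
have [q hq] := exists_orbit hc0 hg hK h0 h1.
have hs := slope_ge0 K.
(* The critical orbit is approached by positive orbits of speeds at most [c]; a negative value would
   survive a small change of speed. *)
have hq0 u : 0 <= u <= 1 -> 0 <= q u.
  move=> hu; apply: Rnot_lt_le => hqu.
  have [|c' hc' [hc'0 [q' hq' hpos']]] := happ (c - - q u / (slope K + 1)).
    by have : 0 < - q u / (slope K + 1) by [apply: Rdiv_lt_0_compat; lra]; lra.
  have := orbit_lipschitz_speed (u := u) hK h0 (_ : 0 <= c' <= c) hq' hq.
  move=> /(_ ltac:(lra) hu) h.
  have : (c - c') * (slope K + 1) < - q u / (slope K + 1) * (slope K + 1).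
    by apply: Rmult_lt_compat_r; lra.
  have -> : - q u / (slope K + 1) * (slope K + 1) = - q u by field; lra.
  have : 0 <= q' u.
    case: (Req_dec u 1) => [-> | hu1]; first by have [_ -> _] := hq'; lra.
    by apply/Rlt_le/hpos'; lra.
  by nra.
have [u1 hu1 hqu1] := critical_orbit_zero hg hK h0 h1 hb hc0 hub hq.
have hc : 0 < c.
  case: (Req_dec c 0) => [e|]; last lra.
  by rewrite e in hq; have := hrest _ _ hq hu1; lra.
have hpos u : 0 < u < 1 -> 0 < q u.
  move=> hu; apply: Rnot_le_lt.
  exact: (critical_orbit_no_interior_zero hg hK h0 hb hc happ hq hq0 hu).
exists c, q; split=> //.
case: (Req_dec u1 0) => [e | hne]; last by have := hpos u1; lra.
by rewrite e in hqu1; have := hq0 0; lra.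
Qed.

(** * Wave profiles *)

(** Above the line of slope [c + K + 1] the momentum exceeds [u], so [- g / p <= K] and
    [p' <= c + K]: the line cannot be crossed. Linear decay at the end states is what keeps the
    profile from reaching them in finite time. *)
Lemma orbit_slope_linear_at0 g c q K u : 0 <= c -> lipschitz01 g K -> g 0 = 0 ->
  orbit g c q -> q 0 = 0 -> 0 <= u <= 1 -> slope (q u) <= (c + K + 1) * u.
Proof.
move=> hc hK h0 hq hq0 hu; have [hK0 _] := hK; have [hqc _ _] := hq.
suff : slope (q u) - (c + K + 1) * u <= 0 by lra.
apply: (@nonpos_barrier (fun v => slope (q v) - (c + K + 1) * v) 0 u); first lra.
- move=> v _; apply: continuous_Rminus.
    by apply: continuous_slope; exact: hqc.
  by apply: continuous_Rmult; [exact: continuous_const | exact: continuous_id].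
- by rewrite hq0 slope_le0; lra.
- move=> v hv hw.
  have hsv : v < slope (q v) by nra.
  have hqv : 0 < q v.
    by apply: Rnot_le_lt => h; rewrite slope_le0 in hsv; lra.
  exists (c - g v / slope (q v) - (c + K + 1)); split.
    apply: (is_derive_minus (fun t => slope (q t)) (fun t => (c + K + 1) * t)).
      by apply: orbit_slope_derive => //; lra.
    by auto_derive => //; ring.
  have /(lipschitz01_at0 hK h0) /Rabs_le_between hgv : 0 <= v <= 1 by lra.
  suff : - g v / slope (q v) <= K by rewrite /Rdiv; lra.
  apply: (Rmult_le_reg_r (slope (q v))); first lra.
  by rewrite /Rdiv Rmult_assoc Rinv_l; [nra | lra].
Qed.

Lemma orbit_slope_linear_at1 g c q K u : 0 <= c -> lipschitz01 g K -> g 1 = 0 ->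
  orbit g c q -> 0 <= u <= 1 -> slope (q u) <= (c + K + 1) * (1 - u).
Proof.
move=> hc hK h1 hq hu; have [hK0 _] := hK; have [hqc hq1 _] := hq.
suff : slope (q u) - (c + K + 1) * (1 - u) <= 0 by lra.
apply: (@nonpos_barrier_left (fun v => slope (q v) - (c + K + 1) * (1 - v)) u 1).
- lra.
- move=> v _; apply: continuous_Rminus.
    by apply: continuous_slope; exact: hqc.
  apply: (is_derive_continuous (l := - (c + K + 1))).
  by auto_derive => //; ring.
- by rewrite hq1 slope_le0; lra.
- move=> v hv hw.
  have hsv : 1 - v < slope (q v) by nra.
  have hqv : 0 < q v.
    by apply: Rnot_le_lt => h; rewrite slope_le0 in hsv; lra.
  exists (c - g v / slope (q v) - - (c + K + 1)); split.
    apply: (is_derive_minus (fun t => slope (q t)) (fun t => (c + K + 1) * (1 - t))).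
      by apply: orbit_slope_derive => //; lra.
    by auto_derive => //; ring.
  have /(lipschitz01_at1 hK h1) /Rabs_le_between hgv : 0 <= v <= 1 by lra.
  suff : g v / slope (q v) <= K by lra.
  apply: (Rmult_le_reg_r (slope (q v))); first lra.
  by rewrite /Rdiv Rmult_assoc Rinv_l; [nra | lra].
Qed.

(* [X] is the inverse of the travel time [x |-> int_0^x 1 / r]. *)
Lemma exists_flow (r : R -> R) (C : R) :
  (forall x, continuous r x) -> (forall x, 0 < r x <= C) ->
  exists X : R -> R, [/\ forall z, is_derive X z (r (X z)),
    is_lim X p_infty p_infty & is_lim X m_infty m_infty].
Proof.
move=> hr hrC.
have hC : 0 < C by have := hrC 0; lra.
pose Z x := RInt (fun t => / r t) 0 x.
have hrinv x : continuous (fun t => / r t) x.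
  apply: (continuous_comp r Rinv) => //; apply: continuous_Rinv.
  by have := hrC x; lra.
have hZd x : is_derive Z x (/ r x).
  exact: (is_derive_RInt_continuous (f := fun t => / r t)).
(* Solved for [y - x], the mean value identity for [Z] serves three times: for surjectivity, for
   monotonicity and for the derivative of the inverse. *)
have hmv x y : exists2 t, Rmin x y <= t <= Rmax x y & y - x = r t * (Z y - Z x).
  have [||t [ht hZ]] := @MVT_gen Z x y (fun t => / r t).
  - by move=> t _; exact: hZd.
  - by move=> t _; apply/continuity_pt_filterlim/(is_derive_continuous (hZd t)).
  exists t => //; rewrite hZ -Rmult_assoc Rinv_r; first by rewrite Rmult_1_l.
  by have := hrC t; lra.
have Z0 : Z 0 = 0 by rewrite /Z RInt_point.
have hsurj z : exists x, Z x = z.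
  have hz := Rabs_pos z.
  (* At speed at most [C], covering a distance [C * Rabs z] takes a time at least [Rabs z]. *)
  have [t1 _ h1] := hmv 0 (C * Rabs z).
  have [t2 _ h2] := hmv (C * - Rabs z) 0.
  rewrite Z0 in h1 h2.
  have [||x [_ hx]] := @IVT_gen_consistent Z (C * - Rabs z) (C * Rabs z) z.
  - by move=> x; exact: (is_derive_continuous (hZd x)).
  - have ha : Rabs z <= Z (C * Rabs z).
      by have := hrC t1; move=> ?; apply: Rnot_lt_le => ?; nra.
    have hb : Z (C * - Rabs z) <= - Rabs z.
      by have := hrC t2; move=> ?; apply: Rnot_lt_le => ?; nra.
    have /Rabs_le_between hzz := Rle_refl (Rabs z).
    rewrite Rmin_left ?Rmax_right; lra.
  by exists x.
have [X hX] := choice _ hsurj.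
have hmono x y : Z x < Z y -> x < y.
  by move=> h; have [t _ ht] := hmv x y; have := hrC t; nra.
have hXlt x z : Z x < z -> x < X z by move=> h; apply: hmono; rewrite hX.
have hXgt x z : z < Z x -> X z < x by move=> h; apply: hmono; rewrite hX.
exists X; split.
- move=> z; apply/is_derive_Reals => eps heps.
  have [d hd hd'] := (proj1 (continuousE r (X z))) (hr (X z)) eps heps.
  have hdC : 0 < d / C by apply: Rdiv_lt_0_compat.
  exists (mkposreal _ hdC) => h hh0 /= hh.
  have [t ht hXt] := hmv (X z) (X (z + h)).
  rewrite !hX in hXt.
  have -> : (X (z + h) - X z) / h = r t by rewrite hXt; field.
  apply: hd'.
  have h1 : Rabs (t - X z) <= Rabs (X (z + h) - X z).
    by move: ht; rewrite /Rmin /Rmax; case: (Rle_dec _ _) => ? ?;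
      rewrite /Rabs; repeat case: (Rcase_abs _) => ?; lra.
  apply: Rle_lt_trans h1 _.
  rewrite hXt; have -> : z + h - z = h by ring.
  rewrite Rabs_mult Rabs_pos_eq; last by have := hrC t; lra.
  apply: (@Rle_lt_trans _ (C * Rabs h)).
    by apply: Rmult_le_compat_r; [exact: Rabs_pos | have := hrC t; lra].
  have -> : d = C * (d / C) by field; lra.
  exact: Rmult_lt_compat_l.
- by apply/is_lim_spec => M; exists (Z M) => z; exact: hXlt.
- by apply/is_lim_spec => M; exists (Z M) => z; exact: hXgt.
Qed.

(* In the logistic coordinate [u = 1 / (1 + exp x)] the equation [u' = - p u]
   becomes [x' = p u / (u (1 - u))], whose right-hand side is bounded. *)
Lemma exists_profile (p : R -> R) (m : R) : (forall u, continuous p u) ->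
  (forall u, 0 < u < 1 -> 0 < p u) ->
  (forall u, 0 < u < 1 -> p u <= m * u) ->
  (forall u, 0 < u < 1 -> p u <= m * (1 - u)) ->
  exists phi : R -> R, [/\ forall z, 0 < phi z < 1,
    forall z, is_derive phi z (- p (phi z)),
    is_lim phi m_infty 1 & is_lim phi p_infty 0].
Proof.
move=> hp hp0 hpl hpr.
pose U x := / (1 + exp x).
have hU x : 0 < U x < 1.
  have := exp_pos x => h; split; first by apply: Rinv_0_lt_compat; lra.
  by rewrite -Rinv_1; apply: Rinv_lt_contravar; lra.
have hUd x : is_derive U x (- (U x * (1 - U x))).
  have := exp_pos x => h; rewrite /U; auto_derive; first lra.
  by field; lra.
pose r x := p (U x) * / (U x * (1 - U x)).
have hU2 x : 0 < U x * (1 - U x) by have := hU x; nra.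
have hUc x : continuous U x by exact: (is_derive_continuous (hUd x)).
(* One of [u] and [1 - u] is at least 1/2, so the two linear bounds give
   [p u <= 2 * m * (u * (1 - u))]. *)
have [||X [hXd hXp hXm]] := @exists_flow r (2 * m).
- move=> x; apply: continuous_Rmult; first exact: (continuous_comp U p).
  apply: (continuous_comp (fun x => U x * (1 - U x)) Rinv).
    apply: continuous_Rmult => //; apply: continuous_Rminus => //.
    exact: continuous_const.
  by apply: continuous_Rinv; have := hU2 x; lra.
- move=> x; have hUx := hU x; have := hp0 _ hUx; have := hpl _ hUx.
  have := hpr _ hUx; have := hU2 x => h1 h2 h3 h4; rewrite /r; split.
    by apply: Rmult_lt_0_compat => //; exact: Rinv_0_lt_compat.
  apply: (Rmult_le_reg_r (U x * (1 - U x))) => //.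
  rewrite Rmult_assoc Rinv_l; last lra.
  by case: (Rle_lt_dec (U x) (1 / 2)) => ?; nra.
exists (fun z => U (X z)); split.
- by move=> z; exact: hU.
- move=> z.
  have -> : - p (U (X z)) = scal (r (X z)) (- (U (X z) * (1 - U (X z)))).
    by rewrite /scal /= /mult /= /r; field; have := hU (X z); lra.
  exact: (is_derive_comp U).
- apply: (is_lim_comp U X m_infty 1 m_infty) => //; last by exists 0.
  have -> : Finite 1 = Rbar_inv (Finite (1 + 0)) by rewrite /= Rplus_0_r Rinv_1.
  apply: (is_lim_inv (fun x => 1 + exp x)); last by move=> [] ?; lra.
  by apply: is_lim_plus'; [exact: is_lim_const | exact: is_lim_exp_m].
- apply: (is_lim_comp U X p_infty 0 p_infty) => //; last by exists 0.
  apply: (is_lim_inv (fun x => 1 + exp x) p_infty p_infty) => //.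
  apply: (is_lim_plus _ _ p_infty 1 p_infty) => //; first exact: is_lim_const.
  exact: is_lim_exp_p.
Qed.

(** The derivatives are explicit functions, so that rescaling and reflection act on formulas instead
    of on [Derive]. *)
Definition wave_profile (A c : R) (g phi phi1 phi2 : R -> R) : Prop :=
  [/\ forall z, is_derive phi z (phi1 z), forall z, is_derive phi1 z (phi2 z),
      forall z, continuous phi2 z &
      forall z, A * phi2 z + c * phi1 z + g (phi z) = 0] /\
  is_lim phi m_infty 1 /\ is_lim phi p_infty 0.

Lemma is_derive_shift (phi : R -> R) z c t l : is_derive phi (z - c * t) l ->
  is_derive (fun s => phi (z - c * s)) t (- c * l) /\
  is_derive (fun y => phi (y - c * t)) z l.
Proof.
move=> hd; split; first apply: (is_derive_comp phi) => //.
  by auto_derive => //; ring.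
have -> : l = scal 1 l by rewrite /scal /= /mult /= Rmult_1_l.
by apply: (is_derive_comp phi) => //; auto_derive => //; ring.
Qed.

Lemma wave_profile_traveling_wave A c g phi phi1 phi2 :
  wave_profile A c g phi phi1 phi2 -> traveling_wave A g c phi.
Proof.
move=> [[h1 h2 hc he] [hm hp]]; split=> //.
have dt t z : is_derive (fun s => phi (z - c * s)) t (- c * phi1 (z - c * t)).
  exact: (proj1 (is_derive_shift (h1 _))).
have dz t z : is_derive (fun y => phi (y - c * t)) z (phi1 (z - c * t)).
  exact: (proj2 (is_derive_shift (h1 _))).
have Ez t z : Derive (fun y => phi (y - c * t)) z = phi1 (z - c * t).
  exact: is_derive_unique.
have dzz t z : is_derive (Derive (fun y => phi (y - c * t))) z (phi2 (z - c * t)).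
  apply: (is_derive_ext (fun y => phi1 (y - c * t))) => [y|]; first by rewrite Ez.
  exact: (proj2 (is_derive_shift (h2 _))).
have Ezz t z : Derive (Derive (fun y => phi (y - c * t))) z = phi2 (z - c * t).
  exact: is_derive_unique.
split=> [t z | p].
  split.
  - by eexists; exact: dt.
  - by eexists; exact: dz.
  - by eexists; exact: dzz.
  - rewrite Ezz (is_derive_unique _ _ _ (dt t z)).
    by have := he (z - c * t); lra.
have hcomp (f : R -> R) : (forall z, continuous f z) ->
    continuous (fun q : R * R => f (q.2 - c * q.1)) p.
  move=> hf; apply: (continuous_comp (fun q : R * R => q.2 - c * q.1) f) => //.
  apply: continuous_Rminus; first exact: continuous_snd.
  by apply: continuous_Rmult; [exact: continuous_const | exact: continuous_fst].
split.
- by apply: hcomp => z; exact: is_derive_continuous (h1 z).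
- apply: (continuous_ext (fun q : R * R => - c * phi1 (q.2 - c * q.1))) => [q|].
    by rewrite (is_derive_unique _ _ _ (dt q.1 q.2)).
  apply: continuous_Rmult; first exact: continuous_const.
  by apply: hcomp => z; exact: is_derive_continuous (h2 z).
- apply: (continuous_ext (fun q : R * R => phi1 (q.2 - c * q.1))) => [q|].
    by rewrite Ez.
  by apply: hcomp => z; exact: is_derive_continuous (h2 z).
- apply: (continuous_ext (fun q : R * R => phi2 (q.2 - c * q.1))) => [q|].
    by rewrite Ezz.
  exact: hcomp.
Qed.

(** The slice [t = 0] of the solution is [phi] itself, and its time derivative there is
    [- c * phi']. *)
Lemma traveling_wave_profile A c g phi : traveling_wave A g c phi ->
  wave_profile A c g phi (Derive phi) (Derive (Derive phi)).
Proof.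
move=> [[hd hc] hm hp]; split=> //.
have e0 (f : R -> R) : (fun z => f (z - c * 0)) = f.
  by apply: functional_extensionality => z; rewrite Rmult_0_r Rminus_0_r.
have d1 z : is_derive phi z (Derive phi z).
  by apply: Derive_correct; have [_ + _ _] := hd 0 z; rewrite e0.
split=> // z.
- by apply: Derive_correct; have [_ _ + _] := hd 0 z; rewrite e0.
- have [_ _ _ h] := hc (0, z).
  have -> : Derive (Derive phi) =
     (fun y => Derive (Derive (fun x => phi (x - c * (0, y).1))) (0, y).2).
    by rewrite /= e0.
  apply: (continuous_comp (fun y => (0, y))
    (fun q : R * R => Derive (Derive (fun x => phi (x - c * q.1))) q.2)) => //.
  apply: (continuous_comp_2 (fun _ => 0) id pair) => /=.
  + exact: continuous_const.
  + exact: continuous_id.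
  + by apply: (continuous_ext id); [case | exact: continuous_id].
- have [_ _ _] := hd 0 z; rewrite e0 Rmult_0_r Rminus_0_r.
  have hz : is_derive phi (z - c * 0) (Derive phi z).
    by rewrite Rmult_0_r Rminus_0_r.
  by rewrite (is_derive_unique _ _ _ (proj1 (is_derive_shift hz))); lra.
Qed.

(** Orbits are normalized to unit diffusion. Stretching space by [sqrt A] restores [A] and
    multiplies the speed by [sqrt A]. *)
Lemma exists_wave_profile_b A g K : 0 < A -> (forall u, continuous g u) ->
  lipschitz01 g K -> g 0 = 0 -> g 1 = 0 -> condition_b g ->
  exists c phi phi1 phi2, 0 < c /\ wave_profile A c g phi phi1 phi2.
Proof.
move=> hA hg hK h0 h1 hb.
have [c [q [hc hq hq0 hpos]]] := exists_critical_orbit hg hK h0 h1 hb.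
have [hqc _ _] := hq; have hc' := Rlt_le _ _ hc.
pose p u := slope (q u).
have hpc u : continuous p u by apply: continuous_slope; exact: hqc.
have [|||phi [hphi hd hm hp]] := @exists_profile p (c + K + 1) hpc.
- by move=> u hu; apply: slope_gt0; exact: hpos.
- by move=> u hu; apply: (orbit_slope_linear_at0 hc' hK h0 hq hq0); lra.
- by move=> u hu; apply: (orbit_slope_linear_at1 hc' hK h1 hq); lra.
have hs := sqrt_lt_R0 _ hA; have hss := sqrt_sqrt _ (Rlt_le _ _ hA).
pose k := / sqrt A.
have hk : 0 < k by exact: Rinv_0_lt_compat.
have hAk : A * (k * k) = 1 by rewrite -{1}hss /k; field; lra.
have hdk (f : R -> R) l z : is_derive f (k * z) l ->
    is_derive (fun z => f (k * z)) z (k * l).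
  by move=> hf; apply: (is_derive_comp f) => //; auto_derive => //; ring.
have hphic z : continuous (fun z => phi (k * z)) z.
  exact: is_derive_continuous (hdk _ _ _ (hd (k * z))).
exists (c * sqrt A), (fun z => phi (k * z)), (fun z => - k * p (phi (k * z))),
  (fun z => k * k * (c * p (phi (k * z)) - g (phi (k * z)))).
split; first by apply: Rmult_lt_0_compat.
split; [split|split].
- move=> z; have -> : - k * p (phi (k * z)) = k * - p (phi (k * z)) by ring.
  exact: hdk.
- move=> z; have hz := hphi (k * z); have hpz := slope_gt0 (hpos _ hz).
  have -> : k * k * (c * p (phi (k * z)) - g (phi (k * z))) =
      - k * (k * (- p (phi (k * z)) * (c - g (phi (k * z)) / p (phi (k * z))))).
    by rewrite /p; field; lra.
  apply: (is_derive_scal (fun z => p (phi (k * z)))).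
  apply: (hdk (fun z => p (phi z))); apply: (is_derive_comp p) => //.
  by apply: orbit_slope_derive => //; exact: hpos.
- move=> z; apply: continuous_Rmult; first exact: continuous_const.
  apply: continuous_Rminus.
    apply: continuous_Rmult; first exact: continuous_const.
    exact: (continuous_comp (fun z => phi (k * z)) p).
  exact: (continuous_comp (fun z => phi (k * z)) g).
- move=> z; set P := p _; set G := g _.
  have hsk : sqrt A * k = 1 by rewrite /k Rinv_r; lra.
  have -> : A * (k * k * (c * P - G)) + c * sqrt A * (- k * P) + G =
     (A * (k * k)) * (c * P - G) - c * (sqrt A * k) * P + G by ring.
  by rewrite hAk hsk; ring.
- apply: (is_lim_comp phi (fun z => k * z) m_infty 1 m_infty) => //; last by exists 0.
  apply/is_lim_spec => M; exists (M / k) => z hz.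
  by apply: (Rmult_lt_reg_l (/ k)); [exact: Rinv_0_lt_compat |
    rewrite -Rmult_assoc Rinv_l; lra].
- apply: (is_lim_comp phi (fun z => k * z) p_infty 0 p_infty) => //; last by exists 0.
  apply/is_lim_spec => M; exists (M / k) => z hz.
  by apply: (Rmult_lt_reg_l (/ k)); [exact: Rinv_0_lt_compat |
    rewrite -Rmult_assoc Rinv_l; lra].
Qed.

(* The reflection [u -> 1 - u] exchanges the two conditions. *)
Lemma primitive_reflect g u : (forall u, continuous g u) ->
  primitive (fun u => - g (1 - u)) u = primitive g (1 - u) - primitive g 1.
Proof.
move=> hg; set g' := fun u => _.
have hg' v : continuous g' v.
  apply: continuous_Ropp; apply: (continuous_comp (fun u => 1 - u) g) => //.
  by apply: continuous_Rminus; [exact: continuous_const | exact: continuous_id].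
pose W v := primitive g' v - primitive g (1 - v).
have hW v : is_derive W v 0.
  have -> : 0 = g' v - -1 * g (1 - v) by rewrite /g'; ring.
  apply: (is_derive_minus (primitive g') (fun v => primitive g (1 - v))).
    exact: (is_derive_RInt_continuous (f := g')).
  apply: (is_derive_comp (primitive g)).
    exact: (is_derive_RInt_continuous (f := g)).
  by auto_derive => //; ring.
have [||t [_]] := @MVT_gen W 0 u (fun _ => 0).
- by move=> v _; exact: hW.
- by move=> v _; apply/continuity_pt_filterlim/(is_derive_continuous (hW v)).
have e : primitive g' 0 = 0 by rewrite /primitive RInt_point.
by rewrite /W e Rminus_0_r; lra.
Qed.

Lemma condition_a_reflect g : (forall u, continuous g u) -> condition_a g ->
  condition_b (fun u => - g (1 - u)).
Proof.
move=> hg [hF ha].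
have F0 : primitive g 0 = 0 by rewrite /primitive RInt_point.
split; first by rewrite primitive_reflect // Rminus_diag F0; lra.
move=> u hu; rewrite !primitive_reflect // Rminus_0_r => h.
by have := ha (1 - u); lra.
Qed.

(** Exchanging the states 0 and 1 also exchanges the two limits; reversing [z] puts them back and
    flips the sign of the speed. *)
Lemma wave_profile_reflect A c g phi phi1 phi2 :
  wave_profile A c (fun u => - g (1 - u)) phi phi1 phi2 ->
  wave_profile A (- c) g (fun z => 1 - phi (- z)) (fun z => phi1 (- z))
    (fun z => - phi2 (- z)).
Proof.
move=> [[h1 h2 hc he] [hm hp]].
have hop z : is_derive Ropp z (-1) by auto_derive => //; ring.
split; [split|split].
- move=> z; have -> : phi1 (- z) = 0 - -1 * phi1 (- z) by ring.
  apply: (is_derive_minus (fun _ => 1)); first exact: is_derive_const.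
  exact: (is_derive_comp phi Ropp).
- move=> z; have -> : - phi2 (- z) = -1 * phi2 (- z) by ring.
  exact: (is_derive_comp phi1 Ropp).
- move=> z; apply: continuous_Ropp; apply: (continuous_comp Ropp phi2) => //.
  by apply: continuous_Ropp; exact: continuous_id.
- by move=> z; have := he (- z); lra.
- have hl : is_lim (fun z => phi (- z)) m_infty 0.
    apply: (is_lim_comp phi Ropp m_infty 0 p_infty) => //; last by exists 0.
    exact: (is_lim_opp (fun x => x) m_infty m_infty (is_lim_id _)).
  have := is_lim_minus' _ _ _ _ _ (is_lim_const 1 m_infty) hl.
  by rewrite Rminus_0_r.
- have hl : is_lim (fun z => phi (- z)) p_infty 1.
    apply: (is_lim_comp phi Ropp p_infty 1 m_infty) => //; last by exists 0.
    exact: (is_lim_opp (fun x => x) p_infty p_infty (is_lim_id _)).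
  have := is_lim_minus' _ _ _ _ _ (is_lim_const 1 p_infty) hl.
  by rewrite Rminus_diag.
Qed.

(** An arbitrary wave comes without decay of [phi']. But [phi] varies little on a far unit interval,
    so the mean value theorem finds one point there with a small derivative. *)
Lemma energy_near_limit A (F phi phi1 : R -> R) l eps :
  (forall z, is_derive phi z (phi1 z)) -> continuous F l ->
  is_lim phi p_infty l -> 0 < A -> 0 < eps ->
  exists2 z, 0 < z & Rabs (A * (phi1 z * phi1 z) / 2 + F (phi z) - F l) < eps.
Proof.
move=> hd hF /is_lim_spec hl hA heps.
have [|d hd0 hd'] := (proj1 (continuousE F l)) hF (eps / 2); first lra.
(* The derivative found is below [2 * e] in absolute value, and then
   [A * (2 * e)^2 / 2 <= A * e <= eps / 4]. *)
pose e := Rmin d (Rmin (1 / 2) (eps / (4 * A))).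
have heA : 0 < eps / (4 * A) by apply: Rdiv_lt_0_compat; lra.
have he : 0 < e by apply: Rmin_pos => //; apply: Rmin_pos; lra.
have hed : e <= d by exact: Rmin_l.
have he1 : e <= 1 / 2 by exact: Rle_trans (Rmin_r _ _) (Rmin_l _ _).
have he2 : e <= eps / (4 * A) by exact: Rle_trans (Rmin_r _ _) (Rmin_r _ _).
have [N hN] := hl (mkposreal e he).
pose M := Rmax N 0 + 1.
have hM : N < M /\ 0 < M by rewrite /M; have := Rmax_l N 0; have := Rmax_r N 0; lra.
have [||t [ht hv]] := @MVT_gen phi M (M + 1) phi1.
- by move=> z _; exact: hd.
- by move=> z _; exact/continuity_pt_filterlim/(is_derive_continuous (hd z)).
rewrite Rmin_left in ht; last lra; rewrite Rmax_right in ht; last lra.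
exists t; first lra.
have /= hNt := hN t ltac:(lra).
have /hd' /Rabs_lt_between h1 : Rabs (phi t - l) < d by lra.
have /= /Rabs_lt_between h2 := hN M ltac:(lra).
have /= /Rabs_lt_between h3 := hN (M + 1) ltac:(lra).
have h4 : phi1 t * phi1 t <= 4 * (e * e) by nra.
have h5 : A * e <= eps / 4.
  have -> : eps / 4 = A * (eps / (4 * A)) by field; lra.
  by apply: Rmult_le_compat_l; lra.
have h6 : A * (phi1 t * phi1 t) <= A * (4 * (e * e)).
  by apply: Rmult_le_compat_l; lra.
have h7 : A * (4 * (e * e)) <= A * (2 * e) by apply: Rmult_le_compat_l; nra.
have h8 : 0 <= A * (phi1 t * phi1 t) by apply: Rmult_le_pos; nra.
by apply/Rabs_lt_between; lra.
Qed.

(* The mechanical energy [A phi'^2 / 2 + F phi] has derivative [- c phi'^2]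
   and tends to [F 1] and [F 0] along sequences at the two ends. *)
Lemma wave_profile_speed_sign A c g phi phi1 phi2 : 0 < A ->
  (forall u, continuous g u) -> wave_profile A c g phi phi1 phi2 ->
  (0 < primitive g 1 -> 0 < c) /\ (primitive g 1 < 0 -> c < 0).
Proof.
move=> hA hg [[h1 h2 hc he] [hm hp]].
have F0 : primitive g 0 = 0 by rewrite /primitive RInt_point.
have hFc u : continuous (primitive g) u by exact: (continuous_RInt_upper (f := g)).
pose E z := A * (phi1 z * phi1 z) / 2 + primitive g (phi z).
have hE z : is_derive E z (- c * (phi1 z * phi1 z)).
  have -> : - c * (phi1 z * phi1 z) =
      A / 2 * (phi2 z * phi1 z + phi1 z * phi2 z) + phi1 z * g (phi z).
    have -> : g (phi z) = - (A * phi2 z + c * phi1 z) by have := he z; lra.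
    by field.
  apply: (is_derive_plus _ (fun z => primitive g (phi z))).
    apply: (is_derive_ext (fun z => A / 2 * (phi1 z * phi1 z))) => [t|].
      by rewrite /=; field; lra.
    apply: is_derive_scal; apply: (is_derive_mult phi1 phi1) => //.
    exact: Rmult_comm.
  apply: (is_derive_comp (primitive g)) => //.
  exact: (is_derive_RInt_continuous (f := g)).
have hmv a b : a < b -> exists2 t, 0 <= t & E b - E a = - c * t.
  move=> hab; have [||t [_ ht]] := @MVT_gen E a b (fun z => - c * (phi1 z * phi1 z)).
  - by move=> z _; exact: hE.
  - by move=> z _; exact/continuity_pt_filterlim/(is_derive_continuous (hE z)).
  by exists (phi1 t * phi1 t * (b - a)); [nra | rewrite ht; ring].
have hright eps : 0 < eps -> exists2 z, 0 < z & Rabs (E z) < eps.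
  move=> heps; have [z hz] := energy_near_limit h1 (hFc 0) hp hA heps.
  by rewrite F0 Rminus_0_r => h; exists z.
(* The energy is even in the momentum, so the left end is the right end of [phi (- z)]. *)
have hleft eps : 0 < eps -> exists2 z, z < 0 & Rabs (E z - primitive g 1) < eps.
  move=> heps.
  have h1' z : is_derive (fun z => phi (- z)) z (- phi1 (- z)).
    have -> : - phi1 (- z) = scal (-1) (phi1 (- z)).
      by rewrite /scal /= /mult /=; ring.
    by apply: (is_derive_comp phi Ropp) => //; auto_derive => //; ring.
  have hm' : is_lim (fun z => phi (- z)) p_infty 1.
    apply: (is_lim_comp phi Ropp p_infty 1 m_infty) => //; last by exists 0.
    exact: (is_lim_opp (fun x => x) p_infty p_infty (is_lim_id _)).
  have [z hz h] := energy_near_limit h1' (hFc 1) hm' hA heps.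
  exists (- z); first lra.
  by rewrite /E -(Rmult_opp_opp (phi1 (- z))).
split=> hF; apply: Rnot_le_lt => hc0.
- have [a ha /Rabs_lt_between hEa] := hleft (primitive g 1 / 3) ltac:(lra).
  have [b hb /Rabs_lt_between hEb] := hright (primitive g 1 / 3) ltac:(lra).
  by have [t ht hab] := hmv a b ltac:(lra); nra.
- have [a ha /Rabs_lt_between hEa] := hleft (- primitive g 1 / 3) ltac:(lra).
  have [b hb /Rabs_lt_between hEb] := hright (- primitive g 1 / 3) ltac:(lra).
  by have [t ht hab] := hmv a b ltac:(lra); nra.
Qed.

(** * Regularity of the average *)

(** A tube argument: finitely many product neighborhoods cover the segment. Both values are compared
    with [H t s0] at a center [s0], whence [eps / 2]. *)
Lemma locally_uniform_on_segment (T : UniformSpace) (H : T -> R -> R) a b t eps :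
  (forall p : T * R, continuous (fun q : T * R => H q.1 q.2) p) -> 0 < eps ->
  locally t (fun t' => forall s, a <= s <= b -> Rabs (H t' s - H t s) < eps).
Proof.
move=> hH heps.
have hloc s : exists d : posreal, forall t' s', ball t d t' ->
    Rabs (s' - s) < d -> Rabs (H t' s' - H t s) < eps / 2.
  have heps2 : 0 < eps / 2 by lra.
  have [d hd] := proj1 (filterlim_locally _ _) (hH (t, s)) (mkposreal _ heps2).
  by exists d => t' s' ht hs; exact: (hd (t', s') (conj ht hs)).
have [delta hdelta] := choice _ hloc.
have [d hd] := compactness_value_1d a b delta.
exists d => t' ht s hs; apply: NNPP => hno; apply: (hd s hs) => -[s0 [hs0 [hss0 hds0]]].
apply: hno.
have h1 := hdelta s0 t' s (ball_le _ _ _ hds0 _ ht) hss0.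
have h2 := hdelta s0 t s (ball_center _ _) hss0.
by move: h1 h2 => /Rabs_lt_between h1 /Rabs_lt_between h2; apply/Rabs_lt_between; lra.
Qed.

Lemma continuous_pair (T U V : UniformSpace) (f : T -> U) (g : T -> V) x :
  continuous f x -> continuous g x ->
  continuous (fun y => (f y, g y) : prod_UniformSpace U V) x.
Proof.
move=> hf hg; apply: (continuous_comp_2 f g pair) => //.
by apply: (continuous_ext id); [case | exact: continuous_id].
Qed.

Lemma continuous_proj1 (T U V : UniformSpace) (f : T -> prod_UniformSpace U V) x :
  continuous f x -> continuous (fun y => (f y).1) x.
Proof.
move=> hf; apply: (continuous_comp f (fun q : U * V => q.1)) => //.
exact: continuous_fst.
Qed.

Lemma continuous_proj2 (T U V : UniformSpace) (f : T -> prod_UniformSpace U V) x :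
  continuous f x -> continuous (fun y => (f y).2) x.
Proof.
move=> hf; apply: (continuous_comp f (fun q : U * V => q.2)) => //.
exact: continuous_snd.
Qed.

Lemma continuous_curry (T : UniformSpace) (H : T -> R -> R) t s :
  (forall p : T * R, continuous (fun q : T * R => H q.1 q.2) p) ->
  continuous (H t) s.
Proof.
move=> hH; apply: (continuous_comp (fun s => (t, s)) (fun q : T * R => H q.1 q.2)) => //.
by apply: continuous_pair; [exact: continuous_const | exact: continuous_id].
Qed.

Lemma continuous_RInt_param (T : UniformSpace) (H : T -> R -> R) a b t :
  a <= b -> (forall p : T * R, continuous (fun q : T * R => H q.1 q.2) p) ->
  continuous (fun t => RInt (H t) a b) t.
Proof.
move=> hab hH; apply/filterlim_locally => -[eps heps].
have he : 0 < eps / (b - a + 1) by apply: Rdiv_lt_0_compat; lra.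
have := locally_uniform_on_segment a b t hH he.
apply: filter_imp => t' ht'; rewrite /ball /= /AbsRing_ball /abs /=.
have hex t0 : ex_RInt (H t0) a b.
  by apply: continuous_ex_RInt => s; exact: continuous_curry.
rewrite -RInt_minus //.
apply: (@Rle_lt_trans _ ((b - a) * (eps / (b - a + 1)))).
  apply: abs_RInt_le_const => //; first exact: ex_RInt_minus.
  by move=> s hs; apply/Rlt_le/ht'.
have -> : eps = (b - a + 1) * (eps / (b - a + 1)) by field; lra.
have -> : (b - a + 1) * (eps / (b - a + 1)) / (b - a + 1) = eps / (b - a + 1).
  by field; lra.
nra.
Qed.

Lemma continuous_cons_pt (T : UniformSpace) d (s : T -> R) (y : T -> 'I_d -> R) t :
  continuous s t -> continuous (y : T -> fct_UniformSpace 'I_d R_UniformSpace) t ->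
  continuous (fun t => cons_pt (s t) (y t) :
    fct_UniformSpace 'I_d.+1 R_UniformSpace) t.
Proof.
move=> /filterlim_locally hs /filterlim_locally hy; apply/filterlim_locally => eps.
have [d1 h1] := hs eps; have [d2 h2] := hy eps.
have hd : 0 < Rmin d1 d2 by apply: Rmin_pos; exact: cond_pos.
exists (mkposreal _ hd) => t' ht' i.
rewrite /cons_pt; case: (unlift ord0 i) => [j|].
  by apply: h2; exact: ball_le (Rmin_r _ _) _ ht'.
by apply: h1; exact: ball_le (Rmin_l _ _) _ ht'.
Qed.

(** The parameter space is arbitrary so that the induction can move the outermost coordinate into
    it. *)
Lemma continuous_box_integral d (L : 'I_d -> R) (T : UniformSpace)
    (G : T -> ('I_d -> R) -> R) t :
  (forall i, 0 <= L i) ->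
  (forall p : T * ('I_d -> R),
     continuous (fun q : T * ('I_d -> R) => G q.1 q.2) p) ->
  continuous (fun t => box_integral L (G t)) t.
Proof.
elim: d L T G t => [|d IH] L T G t hL hG /=.
  apply: (continuous_comp (fun t => (t, fun _ : 'I_0 => 0))
    (fun q : T * ('I_0 -> R) => G q.1 q.2)) => //.
  apply: (continuous_pair (V := fct_UniformSpace 'I_0 R_UniformSpace)).
    exact: continuous_id.
  exact: continuous_const.
apply: (continuous_RInt_param (H := fun t s =>
  box_integral _ (fun y => G t (cons_pt s y)))) => // p.
apply: (IH _ (prod_UniformSpace T R_UniformSpace)
  (fun ts y => G ts.1 (cons_pt ts.2 y))) => // q.
apply: (continuous_comp (fun q : (T * R) * ('I_d -> R) =>
  (q.1.1, cons_pt q.1.2 q.2)) (fun q : T * ('I_d.+1 -> R) => G q.1 q.2)) => //.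
have hfst : continuous (fun q : (T * R) * ('I_d -> R) => q.1) q by exact: continuous_fst.
apply: continuous_pair; first exact: continuous_proj1 hfst.
by apply: continuous_cons_pt; [exact: continuous_proj2 hfst | exact: continuous_snd].
Qed.

Lemma box_integral_linear d (L : 'I_d -> R) (G0 G1 G2 : ('I_d -> R) -> R) h :
  (forall i, 0 <= L i) -> (forall x, continuous G1 x) ->
  (forall x, continuous G2 x) -> (forall x, G0 x = G1 x + h * G2 x) ->
  box_integral L G0 = box_integral L G1 + h * box_integral L G2.
Proof.
elim: d L G0 G1 G2 => [|d IH] L G0 G1 G2 hL h1 h2 h0 /=; first exact: h0.
have hcons (G : ('I_d.+1 -> R) -> R) (q : R * ('I_d -> R)) :
    (forall x, continuous G x) -> continuous (fun q => G (cons_pt q.1 q.2)) q.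
  move=> hG; apply: (continuous_comp (fun q : R * ('I_d -> R) => cons_pt q.1 q.2) G) => //.
  by apply: continuous_cons_pt; [exact: continuous_fst | exact: continuous_snd].
have hslice (G : ('I_d.+1 -> R) -> R) s y :
    (forall x, continuous G x) -> continuous (fun y => G (cons_pt s y)) y.
  move=> hG; apply: (continuous_comp (fun y : 'I_d -> R => cons_pt s y) G) => //.
  by apply: continuous_cons_pt; [exact: continuous_const | exact: continuous_id].
pose B (G : ('I_d.+1 -> R) -> R) s :=
  box_integral (fun i => L (lift ord0 i)) (fun y => G (cons_pt s y)).
have hB (G : ('I_d.+1 -> R) -> R) : (forall x, continuous G x) ->
    ex_RInt (B G) 0 (L ord0).
  move=> hG; apply: continuous_ex_RInt => s.
  apply: (continuous_box_integral (T := R_UniformSpace)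
    (G := fun s y => G (cons_pt s y))) => // q.
  exact: hcons.
rewrite -!/(B _).
have -> : RInt (B G0) 0 (L ord0) =
    RInt (fun s => plus (B G1 s) (scal h (B G2 s))) 0 (L ord0).
  apply: RInt_ext => s _; rewrite /plus /scal /= /mult /=.
  by apply: IH => // y; exact: hslice.
rewrite RInt_plus; [|exact: hB|by apply: ex_RInt_scal; exact: hB].
by rewrite RInt_scal //; exact: hB.
Qed.

(** By Hadamard's formula, [f x (u + h) - f x u] is [h] times the continuous function [M (u, h) x],
    also at [h = 0]. Integrating in [x] turns the difference quotient of the average into the
    continuous [Q (u, h)], so the derivative is [Q (u, 0)]. *)
Lemma average_C1 d (L : 'I_d -> R) f : (forall i, 0 < L i) -> class_C1 f ->
  exists2 dg : R -> R, forall u, continuous dg u &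
    forall u, is_derive (average L f) u (dg u).
Proof.
move=> hL [hf _ hfu _ hD].
have hL0 i : 0 <= L i by apply: Rlt_le.
pose M (p : R * R) x := RInt (fun s => partial_u f x (p.1 + s * p.2)) 0 1.
have hDs x u : continuous (partial_u f x) u.
  apply: (continuous_comp (fun u => (x, u))
    (fun q : ('I_d -> R) * R => partial_u f q.1 q.2)); last exact: hD.
  by apply: continuous_pair; [exact: continuous_const | exact: continuous_id].
have hM (q : (R * R) * ('I_d -> R)) :
    continuous (fun q : (R * R) * ('I_d -> R) => M q.1 q.2) q.
  apply: (continuous_RInt_param
    (T := prod_UniformSpace (prod_UniformSpace R_UniformSpace R_UniformSpace)
            (fct_UniformSpace 'I_d R_UniformSpace))
    (H := fun q s => partial_u f q.2 (q.1.1 + s * q.1.2))); first lra.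
  move=> p; apply: (continuous_comp
    (fun p : ((R * R) * ('I_d -> R)) * R =>
       (p.1.2, p.1.1.1 + p.2 * p.1.1.2))
    (fun q : ('I_d -> R) * R => partial_u f q.1 q.2)); last exact: hD.
  have hq : continuous (fun p : ((R * R) * ('I_d -> R)) * R => p.1) p.
    exact: continuous_fst.
  have huh := continuous_proj1 hq.
  apply: continuous_pair; first exact: continuous_proj2 hq.
  apply: continuous_Rplus; first exact: continuous_proj1 huh.
  by apply: continuous_Rmult; [exact: continuous_snd | exact: continuous_proj2 huh].
have hMx p x : continuous (M p) x.
  apply: (continuous_comp (fun x => (p, x))
    (fun q : (R * R) * ('I_d -> R) => M q.1 q.2)); last exact: hM.
  by apply: continuous_pair; [exact: continuous_const | exact: continuous_id].
have hfx u x : continuous (fun x => f x u) x.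
  apply: (continuous_comp (fun x => (x, u))
    (fun q : ('I_d -> R) * R => f q.1 q.2)); last exact: hf.
  by apply: continuous_pair; [exact: continuous_id | exact: continuous_const].
have hfM x u h : f x (u + h) = f x u + h * M (u, h) x.
  have hder s : is_derive (fun s => f x (u + s * h)) s (h * partial_u f x (u + s * h)).
    apply: (is_derive_comp (f x)); first exact: Derive_correct.
    by auto_derive => //; ring.
  have hsc s : continuous (fun s => partial_u f x (u + s * h)) s.
    apply: (continuous_comp (fun s => u + s * h)) => //.
    apply: continuous_Rplus; first exact: continuous_const.
    by apply: continuous_Rmult; [exact: continuous_id | exact: continuous_const].
  have : RInt (fun s => h * partial_u f x (u + s * h)) 0 1 =
      minus (f x (u + 1 * h)) (f x (u + 0 * h)).
    apply: is_RInt_unique; apply: (is_RInt_derive (fun s => f x (u + s * h))) => //.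
    by move=> s _; apply: continuous_Rmult => //; exact: continuous_const.
  have -> : RInt (fun s => h * partial_u f x (u + s * h)) 0 1 = h * M (u, h) x.
    by apply: RInt_scal; exact: continuous_ex_RInt.
  by rewrite Rmult_1_l Rmult_0_l Rplus_0_r => ->; rewrite /minus /plus /opp /=; ring.
pose c := / (\big[Rmult/1]_(i < d) L i).
pose Q p := c * box_integral L (M p).
have hQ p : continuous Q p.
  apply: continuous_Rmult; first exact: continuous_const.
  exact: (continuous_box_integral
    (T := prod_UniformSpace R_UniformSpace R_UniformSpace)).
have havg u h : average L f (u + h) = average L f u + h * Q (u, h).
  rewrite /average -/c (box_integral_linear (G0 := fun x => f x (u + h))
    (G1 := fun x => f x u) (G2 := M (u, h)) (h := h)) //.
  by rewrite /Q; ring.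
exists (fun u => Q (u, 0)) => u.
  apply: (continuous_comp (fun u => (u, 0)) Q) => //.
  by apply: continuous_pair; [exact: continuous_id | exact: continuous_const].
apply/is_derive_Reals => eps heps.
have hQu : continuous (fun h => Q (u, h)) 0.
  apply: (continuous_comp (fun h => (u, h)) Q) => //.
  by apply: continuous_pair; [exact: continuous_const | exact: continuous_id].
have [e he he'] := (proj1 (continuousE _ _)) hQu eps heps.
exists (mkposreal e he) => h h0 hh; rewrite havg.
have -> : (average L f u + h * Q (u, h) - average L f u) / h = Q (u, h) by field.
by apply: he'; rewrite Rminus_0_r.
Qed.

Lemma C1_lipschitz01 (g dg : R -> R) : (forall u, continuous dg u) ->
  (forall u, is_derive g u (dg u)) -> exists K, lipschitz01 g K.
Proof.
move=> hdg hg.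
have [m [hm _]] := @continuity_ab_maj (fun u => Rabs (dg u)) 0 1 Rle_0_1
  (fun u _ => proj2 (continuity_pt_filterlim _ _)
     (continuous_comp dg Rabs u (hdg u) (continuous_Rabs _))).
exists (Rabs (dg m)); split; first exact: Rabs_pos.
move=> u v hu hv.
have [||t [ht ->]] := @MVT_gen g v u dg.
- by move=> t _; exact: hg.
- by move=> t _; exact/continuity_pt_filterlim/(is_derive_continuous (hg t)).
rewrite Rabs_mult; apply: Rmult_le_compat_r; first exact: Rabs_pos.
apply: hm; move: ht; rewrite /Rmin /Rmax; case: (Rle_dec _ _) => ?; lra.
Qed.

Theorem proposition1p1
  (d : nat) (hd : (0 < d)%N)
  (A0 : R) (hA0 : 0 < A0)
  (L : 'I_d -> R) (hL : forall i, 0 < L i)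
  (f : ('I_d -> R) -> R -> R)
  (hC1 : class_C1 f)
  (hper : periodic_x L f)
  (hlip : locally_lipschitz_u (partial_u f))
  (h0 : average L f 0 = 0)
  (h1 : average L f 1 = 0) :
  (condition_a (average L f) \/ condition_b (average L f) ->
     exists c0 : R, c0 <> 0 /\
       exists phi0 : R -> R, traveling_wave A0 (average L f) c0 phi0) /\
  (forall (c0 : R) (phi0 : R -> R),
     traveling_wave A0 (average L f) c0 phi0 ->
     (condition_b (average L f) -> c0 > 0) /\
     (condition_a (average L f) -> c0 < 0)).
Proof.
have [dg hdg hg] := average_C1 hL hC1.
have hgc u : continuous (average L f) u by exact: is_derive_continuous (hg u).
have [K hK] := C1_lipschitz01 hdg hg.
split=> [[ha | hb] | c phi /traveling_wave_profile hphi].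
- have [|||||c [phi [phi1 [phi2 [hc hphi]]]]] :=
    @exists_wave_profile_b A0 (fun u => - average L f (1 - u)) K hA0.
  + move=> u; apply: continuous_Ropp.
    apply: (continuous_comp (fun u => 1 - u) (average L f)) => //.
    by apply: continuous_Rminus; [exact: continuous_const | exact: continuous_id].
  + have [hK0 hKL] := hK; split=> // u v hu hv.
    have -> : - average L f (1 - u) - - average L f (1 - v) =
      average L f (1 - v) - average L f (1 - u) by ring.
    have -> : u - v = (1 - v) - (1 - u) by ring.
    by apply: hKL; lra.
  + by rewrite Rminus_0_r h1 Ropp_0.
  + by rewrite Rminus_diag h0 Ropp_0.
  + exact: condition_a_reflect.
  exists (- c); split; first lra.
  exists (fun z => 1 - phi (- z)).
  exact: wave_profile_traveling_wave (wave_profile_reflect hphi).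
- have [c [phi [phi1 [phi2 [hc hphi]]]]] :=
    exists_wave_profile_b hA0 hgc hK h0 h1 hb.
  exists c; split; first lra.
  exists phi; exact: wave_profile_traveling_wave hphi.
- have F0 : primitive (average L f) 0 = 0 by rewrite /primitive RInt_point.
  have [hpos hneg] := wave_profile_speed_sign hA0 hgc hphi.
  by split=> -[hF _]; [exact: hpos | exact: hneg].
Qed.
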